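(* Let $(M,\phi_\alpha,\xi_\alpha,\eta_\alpha,g)$, $\alpha\in\{1,2,3\}$, be an almost $3$-contact metric manifold. Then there exists a unique linear connection $\tilde\nabla$ on $M$ satisfying the following properties: (i) $\tilde\nabla\xi_1=\tilde\nabla\xi_2=\tilde\nabla\xi_3=0$; (ii) $(\tilde\nabla_Z g)(X,Y)=0$ for all $X,Y,Z\in\Gamma(\mathcal H)$; (iii) the torsion $\tilde T$ of $\tilde\nabla$ satisfies $\tilde T(X,Y)=2\sum_{\alpha=1}^3 d\eta_\alpha(X,Y)\xi_\alpha$ and $\tilde T(X,\xi_\alpha)=0$ for all $X,Y\in\Gamma(\mathcal H)$ and all $\alpha\in\{1,2,3\}$. Furthermore, if $M$ is $3$-Sasakian, then for all $E,F\in\Gamma(TM)$ and each $\alpha\in\{1,2,3\}$ $$(\tilde\nabla_E\phi_\alpha)F=-\sum_{\beta,\gamma=1}^3\epsilon_{\alpha\beta\gamma}\left(\eta_\beta(E)\phi_\gamma F^h-\eta_\gamma(E)\phi_\beta F^h\right);$$ if $M$ is $3$-cosymplectic, then the connection $\tilde\nabla$ coincides with the Levi-Civita connection of $g$, and in particular $\tilde\nabla\phi_\alpha=0$ for each $\alpha\in\{1,2,3\}$.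
   Context: An almost contact structure on an odd-dimensional manifold $M$ is a triple $(\phi,\xi,\eta)$ with $\phi$ a $(1,1)$-tensor field, $\xi$ a vector field, $\eta$ a $1$-form, such that $\phi^2=-I+\eta\otimes\xi$, $\eta(\xi)=1$. It is normal if $[\phi,\phi]+2d\eta\otimes\xi=0$, where $[\phi,\phi]$ is the Nijenhuis tensor of $\phi$. A Riemannian metric $g$ is compatible if $g(\phi E,\phi F)=g(E,F)-\eta(E)\eta(F)$; then the fundamental $2$-form is $\Phi(E,F)=g(E,\phi F)$. An almost $3$-contact metric manifold is a $(4n+3)$-dimensional smooth manifold with three almost contact structures $(\phi_\alpha,\xi_\alpha,\eta_\alpha)$ and a Riemannian metric $g$ compatible with each of them, such that for all $\alpha,\beta\in\{1,2,3\}$: $\phi_\alpha\phi_\beta-\eta_\beta\otimes\xi_\alpha=\sum_\gamma\epsilon_{\alpha\beta\gamma}\phi_\gamma-\delta_{\alpha\beta}I$, $\phi_\alpha\xi_\beta=\sum_\gamma\epsilon_{\alpha\beta\gamma}\xi_\gamma$, $\eta_\alpha\circ\phi_\beta=\sum_\gamma\epsilon_{\alpha\beta\gamma}\eta_\gamma$, where $\epsilon_{\alpha\beta\gamma}$ is the totally antisymmetric symbol. It is $3$-Sasakian if for each $\alpha$ one has $d\eta_\alpha=\Phi_\alpha$ and the structure is normal; it is $3$-cosymplectic if for each $\alpha$ one has $d\eta_\alpha=0$, $d\Phi_\alpha=0$ and the structure is normal. The horizontal distribution is $\mathcal H=\bigcap_{\alpha=1}^3\ker\eta_\alpha$, the vertical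 one is $\langle\xi_1,\xi_2,\xi_3\rangle$, and $TM=\mathcal H\oplus\langle\xi_1,\xi_2,\xi_3\rangle$ orthogonally; $F^h$ denotes the horizontal component of $F$. Let $\nabla$ be the Levi-Civita connection of $g$. The notation $\tilde\nabla$ is used for the canonical connection, determined by $\tilde\nabla_XY=(\nabla_XY)^h$, $\tilde\nabla_{\xi_\alpha}Y=[\xi_\alpha,Y]$, $\tilde\nabla\xi_\alpha=0$ for $X,Y\in\Gamma(\mathcal H)$. Convention: $2d\eta(E,F)=E(\eta(F))-F(\eta(E))-\eta([E,F])$; $\tilde T(E,F)=\tilde\nabla_EF-\tilde\nabla_FE-[E,F]$.
   Formalization: Uniqueness from (i)–(iii) alone fails (add g(E^h,F^h)ξ_1 to the connection), so the connection is also required to satisfy: ∇̃_X Y is horizontal for all horizontal X, Y, as holds for the canonical connection; existence includes this property. *)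

(* Defs.v *)
From mathcomp Require Export all_boot all_order all_algebra.
From mathcomp Require Export all_classical all_reals all_analysis.
Export Order.TTheory GRing.Theory Num.Theory.
Export numFieldNormedType.Exports.
Set Implicit Arguments.
Unset Strict Implicit.
Unset Printing Implicit Defensive.

Global Open Scope classical_set_scope.
Global Open Scope ring_scope.

Section Smoothness.
Variables (R : realType) (V W : normedModType R).

(* Class C^k on an open set U: the derivatives in every fixed direction are
   again of class C^(k-1). *)
Fixpoint Ck_on (k : nat) (U : set V) (f : V -> W) : Prop :=
  match k with
  | 0 => forall x, U x -> {for x, continuous f}
  | k'.+1 => (forall x, U x -> differentiable f x) /\
             (forall v : V, Ck_on k' U (fun x => 'D_v f x))
  end.

Definition smooth_on (U : set V) (f : V -> W) : Prop :=
  forall k, Ck_on k U f.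

End Smoothness.

(* A chart of M with values in R^m; outside [chart_dom] and its image the two
   maps are irrelevant. *)
Record chart (R : realType) (m : nat) (M : topologicalType) := Chart {
  chart_dom : set M;
  chart_fun :> M -> 'rV[R]_m;
  chart_inv : 'rV[R]_m -> M;
  chart_dom_open : open chart_dom;
  chart_cod_open : open (chart_fun @` chart_dom);
  chart_funK : forall p, chart_dom p -> chart_inv (chart_fun p) = p;
  chart_fun_cont : forall p, chart_dom p -> {for p, continuous chart_fun};
  chart_inv_cont : forall x, (chart_fun @` chart_dom) x ->
    {for x, continuous chart_inv} }.

(* A smooth manifold without boundary of dimension m: the smooth structure is
   the one generated by the atlas, and a preferred chart around each point is
   fixed once and for all. *)
Record smoothManifold (R : realType) (m : nat) := SmoothManifold {
  carrier :> topologicalType;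
  manifold_hausdorff : hausdorff_space carrier;
  manifold_second_countable : @second_countable carrier;
  atlas : set (chart R m carrier);
  atlas_compatible : forall c c', atlas c -> atlas c' ->
    smooth_on (c @` (chart_dom c `&` chart_dom c')) (c' \o chart_inv c);
  chart_at : carrier -> chart R m carrier;
  chart_at_atlas : forall p, atlas (chart_at p);
  chart_at_dom : forall p, chart_dom (chart_at p) p }.

Section Fields.
Variables (R : realType) (m : nat) (M : smoothManifold R m).
Implicit Types (c : chart R m M) (p q : M) (f : M -> R).

(* The tangent space at p is R^m: the vector v stands for the class of
   curves whose velocity, read in the preferred chart [chart_at p], is v.
   A vector field is thus a function of the following type. *)
Definition field := M -> 'rV[R]_m.
Definition form1 := M -> {scalar 'rV[R]_m}.
Definition tensor11 := M -> {linear 'rV[R]_m -> 'rV[R]_m}.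
Definition form2 := M -> 'rV[R]_m -> 'rV[R]_m -> R.

Implicit Types (E F G X Y Z : field).

Definition chart_cod c : set 'rV[R]_m := c @` chart_dom c.

(* Coordinates in the chart c of the tangent vector v at p. *)
Definition coord c p (v : 'rV[R]_m) : 'rV[R]_m :=
  'D_v (c \o chart_inv (chart_at p)) (chart_at p p).

(* Inverse of [coord c p]: the tangent vector at p with coordinates w in c. *)
Definition vect c p (w : 'rV[R]_m) : 'rV[R]_m :=
  'D_w (chart_at p \o chart_inv c) (c p).

Definition local_rep c X (x : 'rV[R]_m) : 'rV[R]_m :=
  coord c (chart_inv c x) (X (chart_inv c x)).

Definition smooth_fun f : Prop := forall c, atlas c ->
  smooth_on (chart_cod c) ((f \o chart_inv c) : 'rV[R]_m -> R^o).

Definition smooth_field X : Prop := forall c, atlas c ->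
  smooth_on (chart_cod c) (local_rep c X).

(* A tensor field is smooth when its components in every chart are. *)
Definition smooth_form1 (eta : form1) : Prop :=
  forall c (w : 'rV[R]_m), atlas c -> smooth_on (chart_cod c)
    ((fun x => let p := chart_inv c x in eta p (vect c p w))
      : 'rV[R]_m -> R^o).

Definition smooth_tensor11 (phi : tensor11) : Prop :=
  forall c (w : 'rV[R]_m), atlas c -> smooth_on (chart_cod c)
    (local_rep c (fun p => phi p (vect c p w))).

Definition smooth_form2 (om : form2) : Prop :=
  forall c (w w' : 'rV[R]_m), atlas c -> smooth_on (chart_cod c)
    ((fun x => let p := chart_inv c x in om p (vect c p w) (vect c p w'))
      : 'rV[R]_m -> R^o).

Record riemannian_metric := RiemannianMetric {
  metric :> M -> 'rV[R]_m -> 'rV[R]_m -> R;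
  metric_sym : forall p u v, metric p u v = metric p v u;
  metric_linear : forall p (a : R) u v w,
    metric p (a *: u + v) w = a * metric p u w + metric p v w;
  metric_pos : forall p u, u != 0 -> 0 < metric p u u;
  metric_smooth : smooth_form2 metric }.

(* Action of a vector field on a function. *)
Definition act E f : M -> R := fun p =>
  'D_(E p) ((f \o chart_inv (chart_at p)) : 'rV[R]_m -> R^o) (chart_at p p).

(* [E, F] = DF(E) - DE(F) in the preferred chart at p. *)
Definition bracket E F : field := fun p =>
  'D_(E p) (local_rep (chart_at p) F) (chart_at p p)
  - 'D_(F p) (local_rep (chart_at p) E) (chart_at p p).

(* Exterior derivatives, with the factor 1/(r+1) on r-forms. *)
Definition d1 (eta : form1) E F : M -> R := fun p =>
  (act E (fun q => eta q (F q)) p - act F (fun q => eta q (E q)) p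
   - eta p (bracket E F p)) / 2%:R.

Definition d2 (om : form2) E F G : M -> R := fun p =>
  (act E (fun q => om q (F q) (G q)) p + act F (fun q => om q (G q) (E q)) p
   + act G (fun q => om q (E q) (F q)) p
   - om p (bracket E F p) (G p) - om p (bracket F G p) (E p)
   - om p (bracket G E p) (F p)) / 3%:R.

(* Only the values of a connection on smooth vector fields are meaningful. *)
Record linear_connection (D : field -> field -> field) : Prop :=
  LinearConnection {
  connection_smooth : forall E F, smooth_field E -> smooth_field F ->
    smooth_field (D E F);
  connection_linearl : forall f E E' F, smooth_fun f ->
    smooth_field E -> smooth_field E' -> smooth_field F -> forall p,
    D (fun q => f q *: E q + E' q) F p = f p *: D E F p + D E' F p;
  connection_additive : forall E F F',
    smooth_field E -> smooth_field F -> smooth_field F' -> forall p,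
    D E (fun q => F q + F' q) p = D E F p + D E F' p;
  connection_leibniz : forall f E F, smooth_fun f ->
    smooth_field E -> smooth_field F -> forall p,
    D E (fun q => f q *: F q) p = f p *: D E F p + act E f p *: F p }.

Definition torsion (D : field -> field -> field) E F : field := fun p =>
  D E F p - D F E p - bracket E F p.

(* (D_G om)(E, F) *)
Definition cov_form2 (D : field -> field -> field) (om : form2) G E F
    : M -> R := fun p =>
  act G (fun q => om q (E q) (F q)) p - om p (D G E p) (F p)
  - om p (E p) (D G F p).

(* (D_E phi) F *)
Definition cov_tensor11 (D : field -> field -> field) (phi : tensor11) E F
    : field := fun p =>
  D E (fun q => phi q (F q)) p - phi p (D E F p).

Definition levi_civita (g : riemannian_metric) (D : field -> field -> field)
    : Prop :=
  [/\ linear_connection D,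
      forall E F, smooth_field E -> smooth_field F ->
        forall p, torsion D E F p = 0
    & forall G E F, smooth_field G -> smooth_field E -> smooth_field F ->
        forall p, cov_form2 D g G E F p = 0].

Record almost_contact := AlmostContact {
  ac_phi : tensor11;
  ac_xi : field;
  ac_eta : form1;
  ac_phi_smooth : smooth_tensor11 ac_phi;
  ac_xi_smooth : smooth_field ac_xi;
  ac_eta_smooth : smooth_form1 ac_eta;
  ac_phi_sq : forall p v,
    ac_phi p (ac_phi p v) = - v + ac_eta p v *: ac_xi p;
  ac_eta_xi : forall p, ac_eta p (ac_xi p) = 1 }.

Definition nijenhuis (phi : tensor11) E F : field :=
  let app X : field := fun q => phi q (X q) in fun p =>
  phi p (phi p (bracket E F p)) + bracket (app E) (app F) p
  - phi p (bracket (app E) F p) - phi p (bracket E (app F) p).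

Definition normal (S : almost_contact) : Prop :=
  forall E F, smooth_field E -> smooth_field F -> forall p,
    nijenhuis (ac_phi S) E F p
    + (2%:R * d1 (ac_eta S) E F p) *: ac_xi S p = 0.

Definition compatible (S : almost_contact) (g : riemannian_metric) : Prop :=
  forall p u v, g p (ac_phi S p u) (ac_phi S p v)
    = g p u v - ac_eta S p u * ac_eta S p v.

Definition fundamental_form (S : almost_contact) (g : riemannian_metric)
    : form2 := fun p u v => g p u (ac_phi S p v).

End Fields.

(* The totally antisymmetric symbol; the indices 1, 2, 3 are 0, 1, 2 : 'I_3. *)
Definition eps (R : realType) (a b c : 'I_3) : R :=
  (b%:R - a%:R) * (c%:R - a%:R) * (c%:R - b%:R) / 2%:R.

Record almost_3contact_metric (R : realType) (n : nat)
    (M : smoothManifold R (4 * n).+3) := Almost3ContactMetric {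
  str3 : 'I_3 -> almost_contact M;
  met3 : riemannian_metric M;
  met3_compatible : forall a, compatible (str3 a) met3;
  phi_phi3 : forall a b p v,
    ac_phi (str3 a) p (ac_phi (str3 b) p v)
      - ac_eta (str3 b) p v *: ac_xi (str3 a) p
    = (\sum_c eps R a b c *: ac_phi (str3 c) p v) - (a == b)%:R *: v;
  phi_xi3 : forall a b p,
    ac_phi (str3 a) p (ac_xi (str3 b) p)
    = \sum_c eps R a b c *: ac_xi (str3 c) p;
  eta_phi3 : forall a b p v,
    ac_eta (str3 a) p (ac_phi (str3 b) p v)
    = \sum_c eps R a b c * ac_eta (str3 c) p v }.

Section ThreeStructures.
Variables (R : realType) (n : nat) (M : smoothManifold R (4 * n).+3).
Variable S : almost_3contact_metric M.

Definition phi3 a : tensor11 M := ac_phi (str3 S a).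
Definition xi3 a : field M := ac_xi (str3 S a).
Definition eta3 a : form1 M := ac_eta (str3 S a).
Definition Phi3 a : form2 M := fundamental_form (str3 S a) (met3 S).

Definition sasakian3 : Prop := forall a,
  (forall E F, smooth_field E -> smooth_field F -> forall p,
     d1 (eta3 a) E F p = Phi3 a p (E p) (F p)) /\
  normal (str3 S a).

Definition cosymplectic3 : Prop := forall a,
  [/\ forall E F, smooth_field E -> smooth_field F -> forall p,
        d1 (eta3 a) E F p = 0,
      forall E F G, smooth_field E -> smooth_field F -> smooth_field G ->
        forall p, d2 (Phi3 a) E F G p = 0
    & normal (str3 S a)].

(* Smooth sections of the horizontal distribution. *)
Definition horizontal (X : field M) : Prop :=
  smooth_field X /\ forall a p, eta3 a p (X p) = 0.

Definition hpart (F : field M) : field M := fun p =>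
  F p - \sum_a eta3 a p (F p) *: xi3 a p.

(* Conditions (i)-(iii) leave the symmetric part of the vertical component of
   D_X Y free for X, Y horizontal: adding g(E^h, F^h) xi_1 to D_E F preserves
   all three.  Uniqueness therefore requires that D restricts, along the
   horizontal distribution, to a connection in that distribution, as does the
   canonical connection defined below. *)
Definition preserves_horizontal (D : field M -> field M -> field M) : Prop :=
  forall X Y, horizontal X -> horizontal Y -> horizontal (D X Y).

Definition parallel_xi (D : field M -> field M -> field M) : Prop :=
  forall a E, smooth_field E -> forall p, D E (xi3 a) p = 0.

Definition horizontally_metric (D : field M -> field M -> field M) : Prop :=
  forall X Y Z, horizontal X -> horizontal Y -> horizontal Z ->
    forall p, cov_form2 D (met3 S) Z X Y p = 0.

Definition torsion_condition (D : field M -> field M -> field M) : Prop :=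
  (forall X Y, horizontal X -> horizontal Y -> forall p,
     torsion D X Y p = 2%:R *: \sum_a d1 (eta3 a) X Y p *: xi3 a p) /\
  (forall a X, horizontal X -> forall p, torsion D X (xi3 a) p = 0).

(* The canonical connection, in terms of the Levi-Civita connection. *)
Definition canonical_connection (D : field M -> field M -> field M) : Prop :=
  exists2 nabla, levi_civita (met3 S) nabla &
  [/\ forall X Y, horizontal X -> horizontal Y -> forall p,
        D X Y p = hpart (nabla X Y) p,
      forall a Y, horizontal Y -> forall p,
        D (xi3 a) Y p = bracket (xi3 a) Y p
    & forall a E, smooth_field E -> forall p, D E (xi3 a) p = 0].

End ThreeStructures.

(* Main.v *)
Require Import Defs.
From HB Require Import structures.
From mathcomp Require Import ring lra.
Set Implicit Arguments.
Unset Strict Implicit.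
Unset Printing Implicit Defensive.

(** Normality, closedness and the axioms on D speak of globally smooth fields only, whereas
    coordinate fields are smooth near a point and are never cut off. Hence two kinds of test. For
    the Levi-Civita connection, which is built from scratch, local fields suffice. Where a
    hypothesis of the theorem is invoked, the defect W of the desired identity is itself a global
    smooth field: the hypothesis yields g(W, W) = 0, and positivity of g concludes. The identity for
    L_(xi_b) phi_a is Cartan's formula. Contracting Phi_a with xi_b gives eta_b o phi_a = - sum_c
    eps_abc eta_c, so closedness of Phi_a gives L_(xi_b) Phi_a = - 2 sum_c eps_abc d eta_c, the 2
    being the normalisation of d on 1-forms. Since Phi_a = g(-, phi_a -) and xi_b preserves g on the
    pairs that occur, the derivative falls on phi_a alone. For b = a every eps vanishes; together
    with L_(xi_a) phi_a = 0, which comes from normality, this is in turn how xi_a is seen to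
    preserve g on ker eta_a. *)

(* The Levi-Civita connection nabla is defined by Koszul's formula, tested on
   the coordinate fields of a chart.  With E = E^h + sum_a eta_a(E) xi_a, the
   connection is
     D_E F = (nabla_(E^h) F^h)^h + sum_a eta_a(E) [xi_a, F^h]
             + sum_b E(eta_b(F)) xi_b.
   Uniqueness: (i) and (iii) reduce D to its values on horizontal fields, where
   (ii) and (iii) give Koszul's formula; the difference of two solutions is a
   smooth horizontal field, against which the formula can be tested, so no
   extension of tangent vectors is needed.
   In both special geometries each Phi_a is closed, each structure is normal and
   d eta_a(xi_a, -) = 0.  Hence xi_a preserves phi_a and g, nabla phi_a vanishes
   on the kernel of eta_a as for Kaehler structures, and contracting
   d Phi_a = 0 with xi_b gives
     g(Z, (L_(xi_b) phi_a) Y) = - 2 sum_c eps_abc d eta_c(Z, Y),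
   which is the asserted formula since d eta_c is Phi_c or 0.  If all eta_a are
   closed then nabla xi_a = 0, because xi_a is also a Killing field. *)

(** * Calculus of smooth maps *)

Section CkClosure.
Variables (R : realType) (V : normedModType R).

(** Differentiability depends on the germ only: with g = f + (g - f), it is enough to treat a
    function vanishing near x, whose first-order expansion is exact. *)
Lemma differentiable_near0 (W : normedModType R) (f : V -> W) x :
  (\near x, f x = 0) -> differentiable f x.
Proof.
move=> f0; have fx0 : f x = 0 by exact: (nbhs_singleton f0).
have f0' : \forall h \near 0, f (h + x) = 0.
  by rewrite (near_shift x) sub0r; near=> y; rewrite /= subrK; near: y.
have E : f \o shift x = cst (f x) + (\0 : V -> W) +o_ 0 id.
  apply/eqaddoP => e e0; near=> h.
  rewrite !fctE /= fx0 addr0 subr0 (near f0' h) // normr0.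
  by rewrite mulr_ge0 // ltW.
apply/diff_locallyP.
have c0 : continuous (\0 : V -> W) by exact: cst_continuous.
by rewrite (diff_unique c0 E).
Unshelve. all: by end_near. Qed.

Lemma near_eq_differentiable (W : normedModType R) (f g : V -> W) x :
  (\near x, f x = g x) -> differentiable f x -> differentiable g x.
Proof.
move=> fg df; rewrite (_ : g = f + (g - f)); last by rewrite addrC subrK.
apply: differentiableD => //; apply: differentiable_near0.
by near=> y; rewrite !fctE (near fg y) ?subrr.
Unshelve. all: by end_near. Qed.

(** [Ck_on] takes derivatives of a function defined everywhere, so it is a condition at each point
    of U separately; smoothness can thus be checked point by point, in whichever chart is
    convenient. *)
Lemma Ck_on_point (W : normedModType R) k (U : set V) (f : V -> W) :
  Ck_on k U f <-> forall x, U x -> Ck_on k [set x] f.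
Proof.
elim: k f => [|k IH] f /=.
  by split=> [H x Ux _ ->|H x Ux]; [exact: H|exact: (H x Ux)].
split=> [[df H] x Ux|H].
  by split=> [_ ->|v]; [exact: df|exact: (IH _).1].
split=> [x Ux|v]; first by have [+ _] := H x Ux; exact.
by apply/IH => x Ux; have [_] := H x Ux; exact.
Qed.

Lemma Ck_on_sub (W : normedModType R) k (U U' : set V) (f : V -> W) :
  U `<=` U' -> Ck_on k U' f -> Ck_on k U f.
Proof.
by move=> UU' /Ck_on_point H; apply/Ck_on_point => x /UU'; exact: H.
Qed.

Lemma open_near_eq (W : normedModType R) (U : set V) (f g : V -> W) x :
  open U -> (forall x, U x -> f x = g x) -> U x -> \near x, f x = g x.
Proof. by move=> oU fg Ux; near=> y; apply: fg; near: y; exact: open_nbhs_nbhs.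
Unshelve. all: by end_near. Qed.

Lemma Ck_on_eq (W : normedModType R) k (U : set V) (f g : V -> W) :
  open U -> (forall x, U x -> f x = g x) -> Ck_on k U f -> Ck_on k U g.
Proof.
move=> oU; elim: k f g => [|k IH] f g fg /=.
  move=> cf x Ux; have nfg := open_near_eq oU fg Ux.
  have : f @ x --> g x by rewrite -(fg x Ux); exact: cf.
  by apply: cvg_trans; exact: near_eq_cvg.
move=> [df cf]; split=> [x Ux|v].
  by apply: near_eq_differentiable (df _ Ux); exact: open_near_eq Ux.
apply: IH (cf v) => x Ux; apply: near_eq_derive; exact: open_near_eq Ux.
Qed.

Lemma Ck_onS (W : normedModType R) k (U : set V) (f : V -> W) :
  Ck_on k.+1 U f -> Ck_on k U f.
Proof.
elim: k f => [|k IH] f [df cf].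
  by move=> x Ux; apply: differentiable_continuous; exact: df.
by split=> // v; apply: IH; exact: cf.
Qed.

Lemma Ck_on_cst (W : normedModType R) k (U : set V) (a : W) :
  Ck_on k U (cst a).
Proof.
elim: k a => [|k IH] a /=; first by move=> x _; exact: cst_continuous.
split=> [x _|v]; first exact: differentiable_cst.
rewrite (_ : (fun x => _) = cst 0); first exact: IH.
by apply/funext => x; rewrite derive_cst.
Qed.

Lemma Ck_onD (W : normedModType R) k (U : set V) (f g : V -> W) : open U ->
  Ck_on k U f -> Ck_on k U g -> Ck_on k U (fun x => f x + g x).
Proof.
move=> oU; elim: k f g => [|k IH] f g /=.
  by move=> cf cg x Ux; apply: continuousD; [exact: cf|exact: cg].
move=> [df cf] [dg cg]; split=> [x Ux|v].
  by apply: differentiableD; [exact: df|exact: dg].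
apply: (Ck_on_eq oU _ (IH _ _ (cf v) (cg v))) => x Ux.
by rewrite deriveD //; apply: diff_derivable; [exact: df|exact: dg].
Qed.

Lemma Ck_on_lin (W W' : normedModType R) (L : {linear W -> W'}) k (U : set V)
    (f : V -> W) : open U -> continuous L ->
  Ck_on k U f -> Ck_on k U (fun x => L (f x)).
Proof.
move=> oU cL; elim: k f => [|k IH] f /=.
  move=> cf x Ux; apply: (@continuous_comp _ _ _ f L); first exact: cf.
  exact: cL.
move=> [df cf]; split=> [x Ux|v].
  apply: (@differentiable_comp _ _ _ _ f L); first exact: df.
  exact: linear_differentiable.
apply: (Ck_on_eq oU _ (IH _ (cf v))) => x Ux.
have dL : differentiable L (f x) by exact: linear_differentiable.
have dLf : differentiable (L \o f) x by apply: differentiable_comp => //; exact: df.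
rewrite (deriveE _ dLf) diff_comp //; last exact: df.
by rewrite /= diff_lin // deriveE //; exact: df.
Qed.

Lemma Ck_onM k (U : set V) (f g : V -> R^o) : open U ->
  Ck_on k U f -> Ck_on k U g -> Ck_on k U (fun x => f x * g x).
Proof.
move=> oU; elim: k f g => [|k IH] f g.
  by move=> cf cg x Ux; apply: (@continuousM R V f g x); [exact: cf|exact: cg].
move=> fk gk; move: (fk) (gk) => [df cf] [dg cg]; split=> [x Ux|v].
  by apply: (@differentiableM R V f g); [exact: df|exact: dg].
have H := Ck_onD oU (IH _ _ (Ck_onS fk) (cg v)) (IH _ _ (Ck_onS gk) (cf v)).
apply: (Ck_on_eq oU _ H) => x Ux.
by rewrite (@deriveM R V f g) //; apply: diff_derivable; [exact: df|exact: dg].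
Qed.

Lemma Ck_onV k (U : set V) (f : V -> R^o) : open U ->
  (forall x, U x -> f x != 0) -> Ck_on k U f -> Ck_on k U (fun x => (f x)^-1).
Proof.
move=> oU f0; elim: k => [|k IH].
  move=> cf x Ux; apply: (@continuousV R V f); [exact: f0|exact: cf].
move=> fk; move: (fk) => [df cf]; split=> [x Ux|v].
  by apply: (@differentiableV R V f); [exact: df|exact: f0].
have iv := IH (Ck_onS fk).
have H := Ck_onM oU (Ck_on_cst k U (-1 : R^o))
  (Ck_onM oU (Ck_onM oU iv iv) (cf v)).
apply: (Ck_on_eq oU _ H) => x Ux; symmetry.
rewrite (@deriveV R V f); [|exact: f0|by apply: diff_derivable; exact: df].
by rewrite scaleNr mulN1r -exprVn expr2.
Qed.

Lemma Ck_on_sum (W : normedModType R) (I : Type) (r : seq I) k (U : set V)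
    (f : I -> V -> W) : open U -> (forall i, Ck_on k U (f i)) ->
  Ck_on k U (fun x => \sum_(i <- r) f i x).
Proof.
move=> oU fk; elim: r => [|i r IH].
  rewrite (_ : (fun x => _) = cst 0); first exact: Ck_on_cst.
  by apply/funext => x; rewrite big_nil.
rewrite (_ : (fun x => _) = (fun x => f i x + \sum_(i <- r) f i x)).
  exact: Ck_onD.
by apply/funext => x; rewrite big_cons.
Qed.

End CkClosure.

(** * Maps into row vectors and the chain rule *)

Section CkRow.
Variables (R : realType).

Lemma Ck_on_coord (V : normedModType R) k (U : set V) n (f : V -> 'rV[R]_n) :
  open U ->
  (Ck_on k U f <-> forall i, Ck_on k U (fun x => f x 0 i : R^o)).
Proof.
move=> oU; split=> [fk i|fk].
  have lin : linear (fun A : 'rV[R]_n => A 0 i : R^o).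
    by move=> a A B; rewrite !mxE.
  pose L : {linear 'rV[R]_n -> R^o} := HB.pack (fun A : 'rV[R]_n => A 0 i : R^o)
    (GRing.isLinear.Build _ _ _ _ _ lin).
  by apply: (@Ck_on_lin _ _ _ _ L) => //; exact: coord_continuous.
rewrite (_ : f = fun x => \sum_i f x 0 i *: (delta_mx 0 i : 'rV_n)); last first.
  by apply/funext => x; exact: row_sum_delta.
apply: Ck_on_sum => // i.
have lin : linear (fun a : R^o => a *: (delta_mx 0 i : 'rV[R]_n)).
  by move=> a x y; rewrite scalerDl scalerA.
pose L : {linear R^o -> 'rV[R]_n} := HB.pack (fun a : R^o => a *: delta_mx 0 i)
  (GRing.isLinear.Build _ _ _ _ _ lin).
apply: (@Ck_on_lin _ _ _ _ L) => //.
exact: (@scalel_continuous R 'rV[R]_n).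
Qed.

Lemma derive_coord (V : normedModType R) n (f : V -> 'rV[R]_n) x v i :
  differentiable f x -> 'D_v f x 0 i = 'D_v (fun y => f y 0 i : R^o) x.
Proof.
by move=> df; rewrite derive_mx ?mxE //; exact: diff_derivable.
Qed.

Lemma derive_delta n (W : normedModType R) (f : 'rV[R]_n -> W) x v :
  differentiable f x -> 'D_v f x = \sum_i v 0 i *: 'D_(delta_mx 0 i) f x.
Proof.
move=> df; rewrite deriveE // {1}(row_sum_delta v) linear_sum.
by apply: eq_bigr => i _; rewrite linearZ /= deriveE.
Qed.

Lemma derive_comp (V V' W : normedModType R) (psi : V -> V') (f : V' -> W) x v :
  differentiable psi x -> differentiable f (psi x) ->
  'D_v (f \o psi) x = 'D_('D_v psi x) f (psi x).
Proof.
move=> dpsi df; rewrite !deriveE //; first by rewrite diff_comp.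
exact: differentiable_comp.
Qed.

(** [Ck_on] differentiates in fixed directions only; a variable direction is expanded on the
    standard basis. The chain rule in [Ck_on_comp] uses the same expansion. *)
Lemma Ck_on_derive_along n k (U : set 'rV[R]_n) (f : 'rV[R]_n -> R^o)
    (X : 'rV[R]_n -> 'rV[R]_n) : open U -> Ck_on k.+1 U f -> Ck_on k U X ->
  Ck_on k U (fun x => 'D_(X x) f x).
Proof.
move=> oU [df cf] Xk.
have H : Ck_on k U (fun x => \sum_i X x 0 i * ('D_(delta_mx 0 i) f x : R^o)).
  by apply: Ck_on_sum => // i; apply: Ck_onM => //;
    [exact: ((Ck_on_coord _ _ oU).1 Xk i)|exact: cf].
by apply: (Ck_on_eq oU _ H) => x Ux; rewrite (derive_delta _ (df _ Ux)).
Qed.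

Lemma Ck_on_comp (V : normedModType R) n k (U : set V) (U' : set 'rV[R]_n)
    (psi : V -> 'rV[R]_n) (f : 'rV[R]_n -> R^o) : open U ->
  (forall x, U x -> U' (psi x)) -> Ck_on k U psi -> Ck_on k U' f ->
  Ck_on k U (f \o psi).
Proof.
move=> oU UU'; elim: k f => [|k IH] f.
  move=> cpsi cf x Ux; apply: continuous_comp; first exact: cpsi.
  by apply: cf; exact: UU'.
move=> psik [df cf]; have [dpsi cpsi] := psik; split=> [x Ux|v].
  by apply: differentiable_comp; [exact: dpsi|apply: df; exact: UU'].
have H : Ck_on k U (fun x => \sum_i ('D_v psi x 0 i : R^o)
     * (('D_(delta_mx 0 i) f : _ -> R^o) \o psi) x).
  apply: Ck_on_sum => // i; apply: Ck_onM => //; last exact: IH (Ck_onS psik) (cf _).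
  exact: ((Ck_on_coord _ _ oU).1 (cpsi v) i).
apply: (Ck_on_eq oU _ H) => x Ux.
have dp := dpsi x Ux; have dfx := df _ (UU' x Ux).
by rewrite [RHS]derive_comp // [RHS]derive_delta.
Qed.

End CkRow.

(** * Symmetry of second derivatives *)

Section Schwarz.
Variables (R : realType) (V : normedModType R).
Implicit Types (f : V -> R^o) (a v w x : V).

Lemma is_derive_line f a v (s : R) : differentiable f (a + s *: v) ->
  is_derive s (1 : R) (fun t : R => f (a + t *: v) : R) ('D_v f (a + s *: v)).
Proof.
move=> df; pose psi (t : R) := a + t *: v.
have dpsi : is_diff s psi (0 + *:%R^~ v).
  rewrite (_ : psi = cst a + *:%R^~ v) //; exact: is_diffD.
have dp : differentiable psi s by exact: ex_diff.
apply: DeriveDef.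
  by apply: diff_derivable; apply: (@differentiable_comp _ _ _ _ psi f).
rewrite (@derive_comp _ _ _ _ psi f) // (deriveE _ dp).
have -> : 'd psi s = (0 + *:%R^~ v) :> (R -> V) by exact: diff_val.
by rewrite !fctE add0r scale1r.
Qed.

Lemma MVT_line f a v (h : R) : 0 < h ->
  (forall s, 0 <= s <= h -> differentiable f (a + s *: v)) ->
  exists2 s, 0 <= s <= h & f (a + h *: v) - f a = h * 'D_v f (a + s *: v).
Proof.
move=> h0 df.
have [] := @MVT R (fun t => f (a + t *: v)) (fun t => 'D_v f (a + t *: v)) 0 h h0.
- move=> s /[!in_itv]/= /andP[s0 sh]; apply: is_derive_line; apply: df.
  by rewrite !ltW.
- apply: derivable_within_continuous => s /[!in_itv]/= sh.
  by have [] := is_derive_line (df s sh).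
move=> s /[!in_itv]/= /andP[s0 sh]; rewrite scale0r addr0 subr0 => ->.
by exists s; [rewrite !ltW|rewrite mulrC].
Qed.

(** Two mean value theorems: one along v for the increment y |-> f(y + h w) - f(y), then one along w
    for the derivative of f along v. *)
Lemma second_difference f (U : set V) x v w (h : R) : 0 < h ->
  (forall y, U y -> differentiable f y) ->
  (forall y, U y -> differentiable ('D_v f) y) ->
  (forall s t, 0 <= s <= h -> 0 <= t <= h -> U (x + s *: v + t *: w)) ->
  exists s t, [/\ 0 <= s <= h, 0 <= t <= h &
    f (x + h *: v + h *: w) - f (x + h *: v) - f (x + h *: w) + f x
    = h * (h * 'D_w ('D_v f) (x + s *: v + t *: w))].
Proof.
move=> h0 df ddf Uh; have hh : 0 <= h <= h by rewrite lexx ltW.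
have h00 : (0 : R) <= 0 <= h by rewrite lexx ltW.
have U0 s : 0 <= s <= h -> U (x + s *: v).
  by move=> sh; have := Uh s 0 sh h00; rewrite scale0r addr0.
pose g (y : V) : R^o := f (y + h *: w) - f y.
have dsh (y : V) : differentiable (fun y : V => y + h *: w) y.
  apply: (@differentiableD _ _ _ id (cst (h *: w))) => //.
have Dsh (y : V) : 'D_v (fun y : V => y + h *: w) y = v.
  by rewrite (@deriveD _ _ _ id (cst (h *: w))) ?derive_id ?derive_cst ?addr0 //;
    apply: diff_derivable.
have dg s : 0 <= s <= h -> differentiable g (x + s *: v).
  move=> sh; apply: (@differentiableB _ _ _ (fun y => f (y + h *: w)) f).
    apply: (@differentiable_comp _ _ _ _ (fun y : V => y + h *: w) f) => //.
    by apply: df; exact: Uh.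
  by apply: df; exact: U0.
have [s sh E] := MVT_line h0 dg.
have [t th E'] := @MVT_line ('D_v f) (x + s *: v) w h h0
  (fun t th => ddf _ (Uh s t sh th)).
exists s, t; split=> //; rewrite -E'.
have <- : 'D_v g (x + s *: v) =
   'D_v f (x + s *: v + h *: w) - 'D_v f (x + s *: v).
  have df1 : differentiable f (x + s *: v + h *: w) by apply: df; exact: Uh.
  have df2 : differentiable f (x + s *: v) by apply: df; exact: U0.
  rewrite (@deriveB _ _ _ (fun y => f (y + h *: w)) f); last 2 first.
  - apply: diff_derivable.
    exact: (@differentiable_comp _ _ _ _ (fun y : V => y + h *: w) f).
  - exact: diff_derivable.
  by rewrite (@derive_comp _ _ _ _ (fun y : V => y + h *: w) f) // Dsh.
rewrite -E /g addrAC; ring.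
Qed.

(** The second difference is symmetric in v and w, so it equals h^2 times either mixed derivative at
    some point of a small parallelogram; continuity of both at x brings each within e / 2 of its
    value at x. *)
Lemma derive_schwarz f (U : set V) x v w : open U -> U x -> Ck_on 2 U f ->
  'D_v ('D_w f) x = 'D_w ('D_v f) x.
Proof.
move=> oU Ux [df ddf].
apply/eqP; rewrite -subr_eq0 -normr_le0; apply/ler_addgt0Pr => e e0; rewrite add0r.
have e2 : 0 < e / 2 by rewrite divr_gt0.
have /cvgrPdist_lt/(_ _ e2) c1 := (ddf w).2 v x Ux.
have /cvgrPdist_lt/(_ _ e2) c2 := (ddf v).2 w x Ux.
have : \forall y \near x, [/\ U y,
     `|'D_v ('D_w f) x - 'D_v ('D_w f) y| < e / 2 &
     `|'D_w ('D_v f) x - 'D_w ('D_v f) y| < e / 2].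
  have nU : nbhs x U by exact: open_nbhs_nbhs.
  near=> y; split; [exact: (near nU y)|exact: (near c1 y)|exact: (near c2 y)].
move=> /nbhs_normP[d /= d0 dP].
have Nge0 : 0 < `|v| + `|w| + 1 by rewrite ltr_wpDl // addr_ge0.
(* The parallelogram with sides h v and h w stays in the ball of radius d; the summand 1 keeps the
   denominator positive when v = w = 0. *)
pose h := d / 2 / (`|v| + `|w| + 1).
have h0 : 0 < h by rewrite !divr_gt0.
have hin s t : 0 <= s <= h -> 0 <= t <= h -> ball_ Num.norm x d (x + s *: v + t *: w).
  move=> /andP[s0 sh] /andP[t0 th]; rewrite /ball_ /=.
  have -> : x - (x + s *: v + t *: w) = - (s *: v + t *: w).
    by rewrite -[in LHS]addrA opprD addrA subrr add0r.
  rewrite normrN.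
  apply: (le_lt_trans (ler_normD _ _)); rewrite !normrZ !ger0_norm //.
  apply: (@le_lt_trans _ _ (h * (`|v| + `|w| + 1))).
    rewrite !mulrDr mulr1 -[leLHS]addr0; apply: lerD; last exact: ltW.
    by apply: lerD; apply: ler_wpM2r.
  rewrite /h divfK ?gt_eqF //; lra.
have Uh s t : 0 <= s <= h -> 0 <= t <= h -> U (x + s *: v + t *: w).
  by move=> sh th; have [] := dP _ (hin s t sh th).
have Uh' s t : 0 <= s <= h -> 0 <= t <= h -> U (x + s *: w + t *: v).
  by move=> sh th; rewrite addrAC; exact: Uh.
have [s [t [sh th E1]]] := second_difference h0 df (fun y Uy => (ddf v).1 y Uy) Uh.
have [t' [s' [th' sh' E2]]] := @second_difference f U x w v h h0 df
  (fun y Uy => (ddf w).1 y Uy) Uh'.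
have [_ _ H1] := dP _ (hin s t sh th).
have [_ H2 _] := dP _ (hin s' t' sh' th').
have hn : h != 0 by rewrite gt_eqF.
have D12 : f (x + h *: v + h *: w) - f (x + h *: v) - f (x + h *: w) + f x
    = f (x + h *: w + h *: v) - f (x + h *: w) - f (x + h *: v) + f x.
  by rewrite (addrAC x (h *: w)); congr (_ + _); exact: addrAC.
move: E1; rewrite D12 E2 => /(mulfI hn)/(mulfI hn).
rewrite (addrAC x (t' *: w)) => E.
rewrite -E in H1; rewrite [e]splitr.
apply: ltW; apply: le_lt_trans (ltrD H2 H1).
rewrite [X in _ <= _ + X]distrC; exact: ler_distD.
Unshelve. all: by end_near. Qed.

End Schwarz.

(** * Smoothness near a point *)

Section SmoothGerms.
Variables (R : realType) (V : normedModType R).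

(** One neighbourhood serves all orders of differentiability, so the property is inherited by nearby
    points and by every directional derivative. *)
Definition snear (W : normedModType R) (x : V) (f : V -> W) : Prop :=
  exists2 U, open_nbhs x U & smooth_on U f.

Lemma snear_sub (W : normedModType R) x (f : V -> W) (P : set V) :
  nbhs x P -> snear x f ->
  exists U, [/\ open U, U x, U `<=` P & smooth_on U f].
Proof.
rewrite nbhsE => -[B [oB Bx] BP] [U [oU Ux] sf]; exists (U `&` B); split.
- exact: openI.
- by [].
- by move=> y [_ /BP].
- by move=> k; apply: Ck_on_sub (sf k) => y [].
Qed.

Lemma near_snear (W : normedModType R) x (f : V -> W) :
  snear x f -> \forall y \near x, snear y f.
Proof.
move=> [U [oU Ux] sf]; near=> y; exists U => //; split=> //.
by near: y; exact: open_nbhs_nbhs.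
Unshelve. all: by end_near. Qed.

Lemma snear_eq (W : normedModType R) x (f g : V -> W) :
  (\near x, f x = g x) -> snear x f -> snear x g.
Proof.
move=> fg /(snear_sub fg)[U [oU Ux UP sf]]; exists U => // k.
exact: Ck_on_eq (sf k).
Qed.

Lemma snear_differentiable (W : normedModType R) x (f : V -> W) :
  snear x f -> differentiable f x.
Proof. by move=> [U [oU Ux] sf]; exact: (sf 1%N).1. Qed.

Lemma snear_derivable (W : normedModType R) x v (f : V -> W) :
  snear x f -> derivable f x v.
Proof. by move=> sf; apply: diff_derivable; exact: snear_differentiable. Qed.

Lemma snear_derive (W : normedModType R) x v (f : V -> W) :
  snear x f -> snear x ('D_v f).
Proof. by move=> [U oU sf]; exists U => // k; exact: (sf k.+1).2. Qed.

Lemma snear_cst (W : normedModType R) x (a : W) : snear x (cst a).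
Proof.
by exists setT => [|k]; [split=> //; exact: openT|exact: Ck_on_cst].
Qed.

Lemma snear2 (W W' : normedModType R) x (f : V -> W) (g : V -> W') :
  snear x f -> snear x g ->
  exists2 U, open_nbhs x U & smooth_on U f /\ smooth_on U g.
Proof.
move=> sf [U' oU' sg]; have [] := snear_sub (open_nbhs_nbhs oU') sf.
move=> U [oU Ux UU' sfU]; exists U => //; split=> // k.
exact: Ck_on_sub (sg k).
Qed.

Lemma snearD (W : normedModType R) x (f g : V -> W) :
  snear x f -> snear x g -> snear x (fun y => f y + g y).
Proof.
move=> sf sg; have [U [oU Ux] [sfU sgU]] := snear2 sf sg.
by exists U => // k; exact: Ck_onD.
Qed.

Lemma snearM x (f g : V -> R^o) :
  snear x f -> snear x g -> snear x (fun y => f y * g y).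
Proof.
move=> sf sg; have [U [oU Ux] [sfU sgU]] := snear2 sf sg.
by exists U => // k; exact: Ck_onM.
Qed.

Lemma snearV x (f : V -> R^o) :
  f x != 0 -> snear x f -> snear x (fun y => (f y)^-1).
Proof.
move=> fx0 sf.
have : \near x, f x != 0.
  have /cvgrPdist_lt/(_ `|f x|) cf := differentiable_continuous (snear_differentiable sf).
  have nfx : 0 < `|f x| by rewrite normr_gt0.
  near=> y; apply/eqP => fy0.
  by have := near (cf nfx) y; rewrite fy0 subr0 ltxx => /(_ _)/negP; apply.
move=> /snear_sub/(_ sf)[U [oU Ux UP sfU]].
by exists U => // k; exact: Ck_onV.
Unshelve. all: by end_near. Qed.

Lemma snear_coord n x (f : V -> 'rV[R]_n) :
  snear x f <-> forall i, snear x (fun y => f y 0 i : R^o).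
Proof.
split=> [[U [oU Ux] sf] i|sf].
  by exists U => // k; exact: ((Ck_on_coord _ _ oU).1 (sf k)).
have [B BP] : exists B : 'I_n -> set V, forall i,
    open_nbhs x (B i) /\ smooth_on (B i) (fun y => f y 0 i : R^o).
  suff /choice[B BP] : forall i, exists U,
    open_nbhs x U /\ smooth_on U (fun y => f y 0 i : R^o) by exists B.
  by move=> i; have [U oU sU] := sf i; exists U.
(* Each coordinate comes with its own neighbourhood; there are finitely many, so they can be
   intersected. *)
have : nbhs x (fun y => forall i, B i y).
  by apply: filter_forall => i; apply: open_nbhs_nbhs; have [] := BP i.
rewrite nbhsE => -[U [oU Ux] UB]; exists U => // k.
apply/Ck_on_coord => // i; have [_ sB] := BP i.
by apply: Ck_on_sub (sB k) => y /UB.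
Qed.

Lemma snear_comp n x (psi : V -> 'rV[R]_n) (f : 'rV[R]_n -> R^o) :
  snear x psi -> (exists2 U, open_nbhs (psi x) U & smooth_on U f) ->
  snear x (f \o psi).
Proof.
move=> spsi [U' [oU' U'x] sf].
have nU : nbhs x (psi @^-1` U').
  apply: (differentiable_continuous (snear_differentiable spsi)).
  exact: open_nbhs_nbhs.
have [U [oU Ux UU' sU]] := snear_sub nU spsi.
by exists U => // k; apply: Ck_on_comp (sU k) (sf k).
Qed.

End SmoothGerms.

Section SmoothGermsRow.
Variables (R : realType) (m : nat).

Lemma snear_derive_along x (f : 'rV[R]_m -> R^o) (X : 'rV[R]_m -> 'rV[R]_m) :
  snear x f -> snear x X -> snear x (fun y => 'D_(X y) f y : R^o).
Proof.
move=> sf sX; have [U [oU Ux] [sfU sXU]] := snear2 sf sX.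
by exists U => // k; exact: Ck_on_derive_along.
Qed.

Lemma snear_schwarz x v w (f : 'rV[R]_m -> R^o) : snear x f ->
  'D_v ('D_w f) x = 'D_w ('D_v f) x.
Proof. by move=> [U [oU Ux] sf]; exact: derive_schwarz (sf 2%N). Qed.

(* The first-order terms of D_X D_Y f - D_Y D_X f, by symmetry of second
   derivatives. *)
Lemma derive_commutator x (f : 'rV[R]_m -> R^o) (X Y : 'rV[R]_m -> 'rV[R]_m) :
  snear x f -> snear x X -> snear x Y ->
  'D_('D_(X x) Y x - 'D_(Y x) X x) f x
  = 'D_(X x) (fun y => 'D_(Y y) f y : R^o) x
    - 'D_(Y x) (fun y => 'D_(X y) f y : R^o) x.
Proof.
move=> sf sX sY.
have sfi (i : 'I_m) : snear x ('D_(delta_mx 0 i) f : _ -> R^o) by exact: snear_derive.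
have H (Z : 'rV[R]_m -> 'rV[R]_m) v : snear x Z ->
    'D_v (fun y => 'D_(Z y) f y : R^o) x
    = 'D_('D_v Z x) f x + 'D_v ('D_(Z x) f) x.
  move=> sZ; have sZi := (snear_coord x Z).1 sZ.
  have -> : 'D_v (fun y => 'D_(Z y) f y : R^o) x =
      'D_v (\sum_i (fun y => Z y 0 i * 'D_(delta_mx 0 i) f y : R^o)) x.
    have nsf := near_snear sf; apply: near_eq_derive; near=> y.
    rewrite derive_delta ?fct_sumE //; apply: snear_differentiable.
    exact: (near nsf y).
  rewrite derive_sum; last first.
    move=> i; apply: snear_derivable; exact: snearM.
  have dZ := snear_differentiable sZ; have df := snear_differentiable sf.
  rewrite derive_delta // (snear_schwarz _ _ sf) [X in _ + X]derive_delta; last first.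
    by apply: snear_differentiable; exact: snear_derive.
  rewrite -big_split; apply: eq_bigr => i _ /=.
  rewrite (@deriveM _ _ (fun y => Z y 0 i : R^o) ('D_(delta_mx 0 i) f)); last 2 first.
  - exact: snear_derivable.
  - exact: snear_derivable.
  rewrite (derive_coord _ _ dZ) (snear_schwarz _ v sf) addrC.
  by congr (_ + _); exact: mulrC.
rewrite (H Y _ sY) (H X _ sX).
have df := snear_differentiable sf.
have E := snear_schwarz (X x) (Y x) sf.
rewrite (deriveE _ df) linearB /= -(deriveE _ df) -(deriveE _ df).
rewrite E.
rewrite opprD addrACA.
by rewrite [X in _ = _ + X]subrr addr0.
Unshelve. all: by end_near. Qed.

End SmoothGermsRow.

(** * Smooth germs, derivations and brackets on a manifold *)

(* Sealed copies: conversion must never unfold down to derivatives. *)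
HB.lock Definition der (R : realType) (m : nat) (M : smoothManifold R m)
  (E : field M) (f : M -> R) : M -> R := act E f.

HB.lock Definition lie (R : realType) (m : nat) (M : smoothManifold R m)
  (E F : field M) : field M := bracket E F.

HB.lock Definition sfun (R : realType) (m : nat) (M : smoothManifold R m)
  (p : M) (f : M -> R) : Prop :=
  exists2 c : chart R m M, atlas c /\ chart_dom c p &
    snear (c p) (f \o chart_inv c : 'rV[R]_m -> R^o).

HB.lock Definition fsm (R : realType) (m : nat) (M : smoothManifold R m)
  (p : M) (X : field M) : Prop :=
  exists2 c : chart R m M, atlas c /\ chart_dom c p &
    snear (c p) (local_rep c X).

Section Germs.
Variables (R : realType) (m : nat) (M : smoothManifold R m).
Implicit Types (c : chart R m M) (p q : M) (f g h : M -> R) (X Y E F : field M).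

Definition rep c f : 'rV[R]_m -> R^o := f \o chart_inv c.

Lemma near_chart_dom c p : chart_dom c p -> \forall q \near p, chart_dom c q.
Proof. by move=> cp; apply: open_nbhs_nbhs; split=> //; exact: chart_dom_open. Qed.

(** [chart_inv] is arbitrary outside the image of the chart. Near [c p] it is a true inverse, and
    every passage to coordinates relies on this. *)
Lemma near_chart_inv c p (P : set M) : chart_dom c p -> nbhs p P ->
  \forall x \near c p, [/\ P (chart_inv c x), chart_dom c (chart_inv c x)
                         & c (chart_inv c x) = x].
Proof.
move=> cp nP.
have cpx : chart_cod c (c p) by exists p.
have nc : nbhs (c p) (chart_cod c).
  by apply: open_nbhs_nbhs; split=> //; exact: chart_cod_open.
have nP' : nbhs (c p) (chart_inv c @^-1` P).
  by apply: (chart_inv_cont cpx); rewrite chart_funK.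
near=> x.
have [q cq qx] : chart_cod c x by exact: (near nc x).
split; first exact: (near nP' x).
  by rewrite -qx chart_funK.
by rewrite -qx chart_funK.
Unshelve. all: by end_near. Qed.

Lemma transition_snear c c' p : atlas c -> atlas c' ->
  chart_dom c p -> chart_dom c' p -> snear (c p) (c' \o chart_inv c).
Proof.
move=> ac ac' cp c'p; have S := atlas_compatible ac ac'.
have : nbhs (c p) (c @` (chart_dom c `&` chart_dom c')).
  have := near_chart_inv cp (near_chart_dom c'p).
  by apply: filterS => x [H1 H2 H3]; exists (chart_inv c x).
rewrite nbhsE => -[U oU Usub]; exists U => // k; exact: Ck_on_sub (S k).
Qed.

Lemma act_der : @act R m M = @der R m M.
Proof. by apply/funext => E; apply/funext => f; rewrite der.unlock. Qed.

Lemma bracket_lie : @bracket R m M = @lie R m M.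
Proof. by apply/funext => E; apply/funext => f; rewrite lie.unlock. Qed.

Lemma sfunE p f : sfun p f =
  exists2 c, atlas c /\ chart_dom c p & snear (c p) (rep c f).
Proof. by rewrite sfun.unlock. Qed.

Lemma sfun_rep c p f : atlas c -> chart_dom c p -> sfun p f ->
  snear (c p) (rep c f).
Proof.
rewrite sfunE => ac cp [c' [ac' c'p] sf].
have T := transition_snear ac ac' cp c'p.
have cpK : c' (chart_inv c (c p)) = c' p by rewrite chart_funK.
have S : snear (c p) (rep c' f \o (c' \o chart_inv c)).
  by apply: snear_comp => //=; rewrite cpK; exact: sf.
apply: snear_eq S; have := near_chart_inv cp (near_chart_dom c'p).
by apply: filterS => x [H _ _]; rewrite /rep /= chart_funK.
Qed.

Lemma sfun_at p f : sfun p f -> snear (chart_at p p) (rep (chart_at p) f).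
Proof. by apply: sfun_rep; [exact: chart_at_atlas|exact: chart_at_dom]. Qed.

Lemma near_sfun p f : sfun p f -> \forall q \near p, sfun q f.
Proof.
rewrite sfunE => -[c [ac cp] sf]; have ncp := near_chart_dom cp.
have H : nbhs p (c @^-1` [set x | snear x (rep c f)]).
  exact: (chart_fun_cont cp (near_snear sf)).
near=> q; rewrite sfunE; exists c; first by split=> //; exact: (near ncp q).
exact: (near H q).
Unshelve. all: by end_near. Qed.

Lemma sfun_eq p f g : (\forall q \near p, f q = g q) -> sfun p f -> sfun p g.
Proof.
rewrite !sfunE => fg [c [ac cp] sf]; exists c => //; apply: snear_eq sf.
by have := near_chart_inv cp fg; apply: filterS => x [].
Qed.

Lemma sfun_cst p (a : R) : sfun p (fun=> a).
Proof.
rewrite sfunE; exists (chart_at p).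
  by split; [exact: chart_at_atlas|exact: chart_at_dom].
exact: snear_cst.
Qed.

Lemma sfunD p f g : sfun p f -> sfun p g -> sfun p (fun q => f q + g q).
Proof.
move=> sf sg; rewrite sfunE; exists (chart_at p).
  by split; [exact: chart_at_atlas|exact: chart_at_dom].
by apply: snearD; exact: sfun_at.
Qed.

Lemma sfunM p f g : sfun p f -> sfun p g -> sfun p (fun q => f q * g q).
Proof.
move=> sf sg; rewrite sfunE; exists (chart_at p).
  by split; [exact: chart_at_atlas|exact: chart_at_dom].
by apply: snearM; exact: sfun_at.
Qed.

Lemma sfunV p f : f p != 0 -> sfun p f -> sfun p (fun q => (f q)^-1).
Proof.
move=> f0 sf; rewrite sfunE; exists (chart_at p).
  by split; [exact: chart_at_atlas|exact: chart_at_dom].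
apply: (@snearV _ _ _ (rep (chart_at p) f)); last exact: sfun_at.
by rewrite /rep /= chart_funK //; exact: chart_at_dom.
Qed.

Lemma sfunN p f : sfun p f -> sfun p (fun q => - f q).
Proof.
move=> sf; have := sfunM (sfun_cst p (-1)) sf.
by apply: sfun_eq; near=> q; rewrite mulN1r.
Unshelve. all: by end_near. Qed.

Lemma sfunB p f g : sfun p f -> sfun p g -> sfun p (fun q => f q - g q).
Proof. by move=> sf sg; apply: sfunD => //; exact: sfunN. Qed.

Lemma sfun_sum p (I : Type) (r : seq I) (P : pred I) (f : I -> M -> R) :
  (forall i, sfun p (f i)) -> sfun p (fun q => \sum_(i <- r | P i) f i q).
Proof.
move=> sf; elim: r => [|i r IH].
  by apply: sfun_eq (sfun_cst p 0); near=> q; rewrite big_nil.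
case Pi : (P i); last by apply: sfun_eq IH; near=> q; rewrite big_cons Pi.
by apply: sfun_eq (sfunD (sf i) IH); near=> q; rewrite big_cons Pi.
Unshelve. all: by end_near. Qed.

Lemma sfun_prod p (I : Type) (r : seq I) (f : I -> M -> R) :
  (forall i, sfun p (f i)) -> sfun p (fun q => \prod_(i <- r) f i q).
Proof.
move=> sf; elim: r => [|i r IH].
  by apply: sfun_eq (sfun_cst p 1); near=> q; rewrite big_nil.
by apply: sfun_eq (sfunM (sf i) IH); near=> q; rewrite big_cons.
Unshelve. all: by end_near. Qed.

(** Serves Cramer's rule for the inverse Gram matrix. *)
Lemma sfun_det n p (A : M -> 'M[R]_n) : (forall i j, sfun p (fun q => A q i j)) ->
  sfun p (fun q => \det (A q)).
Proof.
move=> sA; apply: sfun_sum => s; apply: sfunM; first exact: sfun_cst.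
by apply: sfun_prod => i; exact: sA.
Qed.

Lemma sfun_coord c p i : atlas c -> chart_dom c p -> sfun p (fun q => c q 0 i).
Proof.
move=> ac cp; rewrite sfunE; exists c => //.
have H := transition_snear ac ac cp cp.
exact: (snear_coord _ _).1 H i.
Qed.

Lemma smooth_funP f : smooth_fun f <-> forall p, sfun p f.
Proof.
split=> [sf p|sf c ac k].
  rewrite sfunE; exists (chart_at p).
    by split; [exact: chart_at_atlas|exact: chart_at_dom].
  exists (chart_cod (chart_at p)); last exact: sf (chart_at_atlas p).
  by split; [exact: chart_cod_open|exists p => //; exact: chart_at_dom].
apply/Ck_on_point => x [p cp <-]; have [U [oU Ux] sU] := sfun_rep ac cp (sf p).
by apply: Ck_on_sub (sU k) => _ ->.
Qed.

Lemma coord_at p v : coord (chart_at p) p v = v.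
Proof.
rewrite /coord -[RHS](@derive_id _ _ (chart_at p p)); apply: near_eq_derive.
have := near_chart_inv (chart_at_dom p) (near_chart_dom (chart_at_dom p)).
by apply: filterS => x [_ _].
Qed.

Lemma coordP c p (a : R) v w : atlas c -> chart_dom c p ->
  coord c p (a *: v + w) = a *: coord c p v + coord c p w.
Proof.
move=> ac cp; have d := snear_differentiable
  (transition_snear (chart_at_atlas p) ac (chart_at_dom p) cp).
by rewrite /coord (deriveE _ d) linearP /= -(deriveE _ d) -(deriveE _ d).
Qed.

Lemma vectP c p (a : R) v w : atlas c -> chart_dom c p ->
  vect c p (a *: v + w) = a *: vect c p v + vect c p w.
Proof.
move=> ac cp; have d := snear_differentiable
  (transition_snear ac (chart_at_atlas p) cp (chart_at_dom p)).
by rewrite /vect (deriveE _ d) linearP /= -(deriveE _ d) -(deriveE _ d).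
Qed.

(** Chain rule: the two transition maps compose to the identity near [c p]. Consequently [coord] and
    [vect] are mutually inverse. *)
Lemma derive_transition c c' p v : atlas c -> atlas c' ->
  chart_dom c p -> chart_dom c' p ->
  'D_('D_v (c' \o chart_inv c) (c p)) (c \o chart_inv c') (c' p) = v.
Proof.
move=> ac ac' cp c'p.
have T := snear_differentiable (transition_snear ac ac' cp c'p).
have T' := snear_differentiable (transition_snear ac' ac c'p cp).
have cpK : (c' \o chart_inv c) (c p) = c' p by rewrite /= chart_funK.
rewrite -cpK in T' *; rewrite -derive_comp //.
rewrite -[RHS](@derive_id _ _ (c p)); apply: near_eq_derive.
have := near_chart_inv cp (near_chart_dom c'p).
by apply: filterS => x [H1 H2 H3] /=; rewrite chart_funK.
Qed.

Lemma vectK c p v : atlas c -> chart_dom c p -> coord c p (vect c p v) = v.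
Proof.
move=> ac cp; apply: derive_transition => //; first exact: chart_at_atlas.
exact: chart_at_dom.
Qed.

Lemma coordK c p v : atlas c -> chart_dom c p -> vect c p (coord c p v) = v.
Proof.
move=> ac cp; apply: derive_transition => //; first exact: chart_at_atlas.
exact: chart_at_dom.
Qed.

Lemma der_chart c p E f : atlas c -> chart_dom c p -> sfun p f ->
  der E f p = 'D_(coord c p (E p)) (rep c f) (c p).
Proof.
move=> ac cp sf.
have T := snear_differentiable
  (transition_snear (chart_at_atlas p) ac (chart_at_dom p) cp).
have cpK : (c \o chart_inv (chart_at p)) (chart_at p p) = c p.
  by rewrite /= chart_funK //; exact: chart_at_dom.
have sf' := snear_differentiable (sfun_rep ac cp sf).
rewrite /coord -cpK in sf' *; rewrite -derive_comp // der.unlock /act.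
apply: near_eq_derive.
have := near_chart_inv (chart_at_dom p) (near_chart_dom cp).
by apply: filterS => x [H1 H2 H3]; rewrite /rep /= chart_funK.
Qed.

Lemma der_coord c p X i : atlas c -> chart_dom c p ->
  der X (fun q => c q 0 i) p = coord c p (X p) 0 i.
Proof.
move=> ac cp; rewrite (der_chart _ ac cp); last exact: sfun_coord.
rewrite -[in RHS](@derive_id _ _ (c p) (coord c p (X p))).
rewrite (@derive_coord _ _ _ id) //.
apply: near_eq_derive.
have := near_chart_inv cp (near_chart_dom cp).
by apply: filterS => x [_ _ H]; rewrite /rep /= H.
Qed.

Lemma fsmE p X : fsm p X =
  exists2 c, atlas c /\ chart_dom c p & snear (c p) (local_rep c X).
Proof. by rewrite fsm.unlock. Qed.

Lemma sfun_der p X f : fsm p X -> sfun p f -> sfun p (der X f).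
Proof.
rewrite fsmE => -[c [ac cp] sX] sf; rewrite sfunE; exists c => //.
have := snear_derive_along (sfun_rep ac cp sf) sX; apply: snear_eq.
have := near_chart_inv cp (near_sfun sf).
by apply: filterS => x [H1 H2 H3]; rewrite /rep /= (der_chart _ ac H2) // H3.
Qed.

(** Independence of the chart: the components of X in c are the derivatives along X of the
    coordinate functions of c, and [sfun_der] can be computed in the chart where X is known to be
    smooth. *)
Lemma fsm_comp c p X : atlas c -> chart_dom c p ->
  fsm p X <-> forall i, sfun p (fun q => coord c q (X q) 0 i).
Proof.
move=> ac cp; split=> [sX i|sX].
  have := sfun_der sX (sfun_coord i ac cp); apply: sfun_eq.
  have := near_chart_dom cp; apply: filterS => q cq; exact: der_coord.
rewrite fsmE; exists c => //; apply/snear_coord => i; exact: (sfun_rep ac cp (sX i)).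
Qed.

Lemma fsm_rep c p X : atlas c -> chart_dom c p -> fsm p X ->
  snear (c p) (local_rep c X).
Proof.
move=> ac cp sX; apply/snear_coord => i.
exact: (sfun_rep ac cp ((fsm_comp _ ac cp).1 sX i)).
Qed.

Lemma near_fsm p X : fsm p X -> \forall q \near p, fsm q X.
Proof.
rewrite fsmE => -[c [ac cp] sf]; have ncp := near_chart_dom cp.
have H : nbhs p (c @^-1` [set x | snear x (local_rep c X)]).
  exact: (chart_fun_cont cp (near_snear sf)).
near=> q; rewrite fsmE; exists c; first by split=> //; exact: (near ncp q).
exact: (near H q).
Unshelve. all: by end_near. Qed.

Lemma smooth_fieldP X : smooth_field X <-> forall p, fsm p X.
Proof.
split=> [sf p|sf c ac k].
  rewrite fsmE; exists (chart_at p).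
    by split; [exact: chart_at_atlas|exact: chart_at_dom].
  exists (chart_cod (chart_at p)); last exact: sf (chart_at_atlas p).
  by split; [exact: chart_cod_open|exists p => //; exact: chart_at_dom].
apply/Ck_on_point => x [p cp <-]; have [U [oU Ux] sU] := fsm_rep ac cp (sf p).
by apply: Ck_on_sub (sU k) => _ ->.
Qed.

Lemma fsm_eq p X Y : (\forall q \near p, X q = Y q) -> fsm p X -> fsm p Y.
Proof.
rewrite !fsmE => XY [c [ac cp] sX]; exists c; [exact: conj ac cp|apply: snear_eq sX].
have := near_chart_inv cp XY; apply: filterS => x [H _ _].
by rewrite /local_rep H.
Qed.

Lemma fsm_lin p f X Y : sfun p f -> fsm p X -> fsm p Y ->
  fsm p (fun q => f q *: X q + Y q).
Proof.
move=> sf sX sY; have ac := chart_at_atlas p; have cp := chart_at_dom p.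
apply/(fsm_comp _ ac cp) => i.
have := sfunD (sfunM sf ((fsm_comp _ ac cp).1 sX i)) ((fsm_comp _ ac cp).1 sY i).
apply: sfun_eq; have := near_chart_dom cp; apply: filterS => q cq.
by rewrite coordP // !mxE.
Qed.

Lemma coord0 c p : atlas c -> chart_dom c p -> coord c p 0 = 0.
Proof.
move=> ac cp; have := coordP 1 0 0 ac cp.
by rewrite !scale1r addr0 => /(congr1 (fun z => z - coord c p 0));
  rewrite addrK subrr.
Qed.

Lemma fsm0 p : fsm p (fun=> 0).
Proof.
have ac := chart_at_atlas p; have cp := chart_at_dom p.
apply/(fsm_comp _ ac cp) => i; apply: sfun_eq (sfun_cst p 0).
by have := near_chart_dom cp; apply: filterS => q cq; rewrite coord0 // mxE.
Qed.

Lemma fsmZ p f X : sfun p f -> fsm p X -> fsm p (fun q => f q *: X q).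
Proof.
move=> sf sX; apply: fsm_eq (fsm_lin sf sX (fsm0 p)).
by near=> q; rewrite addr0.
Unshelve. all: by end_near. Qed.

Lemma fsmD p X Y : fsm p X -> fsm p Y -> fsm p (fun q => X q + Y q).
Proof.
move=> sX sY; apply: fsm_eq (fsm_lin (sfun_cst p 1) sX sY).
by near=> q; rewrite scale1r.
Unshelve. all: by end_near. Qed.

Lemma fsmN p X : fsm p X -> fsm p (fun q => - X q).
Proof.
move=> sX; apply: fsm_eq (fsmZ (sfun_cst p (-1)) sX).
by near=> q; rewrite scaleN1r.
Unshelve. all: by end_near. Qed.

Lemma fsmB p X Y : fsm p X -> fsm p Y -> fsm p (fun q => X q - Y q).
Proof. by move=> sX sY; exact: (fsmD sX (fsmN sY)). Qed.

Lemma fsm_sum p (I : Type) (r : seq I) (X : I -> field M) :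
  (forall i, fsm p (X i)) -> fsm p (fun q => \sum_(i <- r) X i q).
Proof.
move=> sf; elim: r => [|i r IH].
  by apply: fsm_eq (fsm0 p); near=> q; rewrite big_nil.
by apply: fsm_eq (fsmD (sf i) IH); near=> q; rewrite big_cons.
Unshelve. all: by end_near. Qed.

(* Coordinate fields are smooth on the domain of their chart only, which is why
   smoothness is localised at a point. *)
Definition frame c i : field M := fun q => vect c q (delta_mx 0 i).

Lemma fsm_frame c p i : atlas c -> chart_dom c p -> fsm p (frame c i).
Proof.
move=> ac cp; apply/(fsm_comp _ ac cp) => j.
apply: sfun_eq (sfun_cst p ((delta_mx 0 i : 'rV[R]_m) 0 j)).
by have := near_chart_dom cp; apply: filterS => q cq; rewrite vectK.
Qed.

Lemma frame_sum c p v : atlas c -> chart_dom c p ->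
  v = \sum_i coord c p v 0 i *: frame c i p.
Proof.
move=> ac cp; pose L w := vect c p w.
have lin : linear L by move=> a u w; exact: vectP.
pose LL : {linear 'rV[R]_m -> 'rV[R]_m} := HB.pack L
  (GRing.isLinear.Build _ _ _ _ _ lin).
rewrite -[LHS](coordK _ ac cp) -[LHS]/(LL _) {1}(row_sum_delta (coord c p v)).
by rewrite linear_sum; apply: eq_bigr => i _; rewrite linearZ.
Qed.

End Germs.

(** * Vector fields as derivations *)

Section DerLie.
Variables (R : realType) (m : nat) (M : smoothManifold R m).
Implicit Types (c : chart R m M) (p q : M) (f g h : M -> R)
  (X Y Z E F G : field M).

Lemma act_derE p E f : act E f p = der E f p.
Proof. by rewrite act_der. Qed.

Lemma der_at p E E' f : E p = E' p -> der E f p = der E' f p.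
Proof. by rewrite der.unlock /act => ->. Qed.

Lemma der_eq p E f g : (\forall q \near p, f q = g q) -> der E f p = der E g p.
Proof.
move=> fg; rewrite der.unlock; apply: near_eq_derive.
by have := near_chart_inv (chart_at_dom p) fg; apply: filterS => x [].
Qed.

Lemma der_lin p (a : R) X E F f : sfun p f -> X p = a *: E p + F p ->
  der X f p = a * der E f p + der F f p.
Proof.
move=> sf Xp; have d := snear_differentiable (sfun_at sf).
by rewrite der.unlock /act Xp (deriveE _ d) linearP -(deriveE _ d) -(deriveE _ d).
Qed.

Lemma derD p E f g : sfun p f -> sfun p g ->
  der E (fun q => f q + g q) p = der E f p + der E g p.
Proof.
move=> sf sg; have df := @snear_derivable _ _ _ _ (E p) _ (sfun_at sf).
have dg := @snear_derivable _ _ _ _ (E p) _ (sfun_at sg).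
by rewrite der.unlock; exact: (deriveD df dg).
Qed.

Lemma derM p E f g : sfun p f -> sfun p g ->
  der E (fun q => f q * g q) p = f p * der E g p + der E f p * g p.
Proof.
move=> sf sg; have df := @snear_derivable _ _ _ _ (E p) _ (sfun_at sf).
have dg := @snear_derivable _ _ _ _ (E p) _ (sfun_at sg).
have repE h : rep (chart_at p) h (chart_at p p) = h p.
  by rewrite /rep /= chart_funK //; exact: chart_at_dom.
have := deriveM df dg; rewrite !repE => H.
by rewrite [der E f p * _]mulrC der.unlock; exact: H.
Qed.

Lemma der_cst p E (a : R) : der E (fun=> a) p = 0.
Proof. by rewrite der.unlock; exact: derive_cst. Qed.

Lemma derZ p E (a : R) f : sfun p f ->
  der E (fun q => a * f q) p = a * der E f p.
Proof.
by move=> sf; rewrite derM // ?der_cst ?mul0r ?addr0 //; exact: sfun_cst.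
Qed.

Lemma derN p E f : sfun p f -> der E (fun q => - f q) p = - der E f p.
Proof.
move=> sf; rewrite -mulN1r -derZ //; apply: der_eq.
by near=> q; rewrite mulN1r.
Unshelve. all: by end_near. Qed.

Lemma derB p E f g : sfun p f -> sfun p g ->
  der E (fun q => f q - g q) p = der E f p - der E g p.
Proof. by move=> sf sg; rewrite derD ?derN //; exact: sfunN. Qed.

Lemma der_sum p E (I : Type) (r : seq I) (f : I -> M -> R) :
  (forall i, sfun p (f i)) ->
  der E (fun q => \sum_(i <- r) f i q) p = \sum_(i <- r) der E (f i) p.
Proof.
move=> sf; elim: r => [|i r IH].
  rewrite big_nil -[RHS](der_cst p E 0); apply: der_eq.
  by near=> q; rewrite big_nil.
rewrite big_cons -IH -derD //; last exact: sfun_sum.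
by apply: der_eq; near=> q; rewrite big_cons.
Unshelve. all: by end_near. Qed.

(** The coordinate functions already separate tangent vectors. Identities between brackets thereby
    reduce to identities between derivations. *)
Lemma der_inj p E F : (forall f, sfun p f -> der E f p = der F f p) ->
  E p = F p.
Proof.
have ac := chart_at_atlas p; have cp := chart_at_dom p => EF.
apply/rowP => i; have := EF _ (sfun_coord i ac cp).
by rewrite !der_coord // !coord_at.
Qed.

(** The bracket is defined at each point in that point's own preferred chart. As a commutator of
    derivations it no longer mentions a chart, and its smoothness in p can be read off. *)
Lemma der_lie p E F f : fsm p E -> fsm p F -> sfun p f ->
  der (lie E F) f p = der E (der F f) p - der F (der E f) p.
Proof.
move=> sE sF sf; have ac := chart_at_atlas p; have cp := chart_at_dom p.
have rE := fsm_rep ac cp sE; have rF := fsm_rep ac cp sF.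
have A (X : field M) : local_rep (chart_at p) X (chart_at p p) = X p.
  by rewrite /local_rep chart_funK // coord_at.
have := derive_commutator (sfun_at sf) rE rF; rewrite !A => H.
have B (X Y : field M) : 'D_(X p) (fun y => 'D_(local_rep (chart_at p) Y y)
    (rep (chart_at p) f) y : R^o) (chart_at p p) = der X (der Y f) p.
  rewrite -[RHS](@act_derE p X (der Y f)); apply: near_eq_derive.
  have := near_chart_inv cp (near_sfun sf); apply: filterS => x [H1 H2 H3].
  by rewrite /= (der_chart _ ac H2) // H3.
by rewrite -(B E F) -(B F E) -(@act_derE p (lie E F)) lie.unlock; exact: H.
Qed.

Lemma lieC p E F : lie E F p = - lie F E p.
Proof. by rewrite lie.unlock /bracket opprB. Qed.

Lemma fsm_lie p E F : fsm p E -> fsm p F -> fsm p (lie E F).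
Proof.
move=> sE sF; have ac := chart_at_atlas p; have cp := chart_at_dom p.
apply/(fsm_comp _ ac cp) => i; have sc := sfun_coord i ac cp.
apply: sfun_eq (sfunB (sfun_der sE (sfun_der sF sc)) (sfun_der sF (sfun_der sE sc))).
have ncp := near_chart_dom cp; have nE := near_fsm sE; have nF := near_fsm sF.
near=> q; have cq : chart_dom (chart_at p) q by exact: (near ncp q).
have sEq : fsm q E by exact: (near nE q).
have sFq : fsm q F by exact: (near nF q).
have sq := sfun_coord i ac cq.
rewrite -(der_coord (lie E F) i ac cq).
by rewrite (der_lie sEq sFq sq).
Unshelve. all: by end_near. Qed.

End DerLie.


Section LieBracket.
Variables (R : realType) (m : nat) (M : smoothManifold R m).
Implicit Types (c : chart R m M) (p q : M) (f g h : M -> R)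
  (X Y Z E F G : field M).

Lemma lie_eqr p E F F' : fsm p E -> fsm p F ->
  (\forall q \near p, F q = F' q) -> lie E F p = lie E F' p.
Proof.
move=> sE sF FF'; have sF' := fsm_eq FF' sF.
apply: (@der_inj _ _ _ p _ (lie E F')) => f sf.
rewrite (der_lie sE sF sf) (der_lie sE sF' sf).
have -> : der E (der F f) p = der E (der F' f) p.
  by apply: der_eq; apply: filterS FF' => q; exact: der_at.
by rewrite (der_at (der E f) (nbhs_singleton FF')).
Qed.

Lemma lie_linr p E F G f : fsm p E -> fsm p F -> fsm p G -> sfun p f ->
  lie E (fun q => f q *: F q + G q) p
  = f p *: lie E F p + (der E f p *: F p + lie E G p).
Proof.
move=> sE sF sG sf; apply: (@der_inj _ _ _ p _ (fun q => f q *: lie E F q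
  + (der E f q *: F q + lie E G q))) => h sh.
have sFGh := sfun_der (fsm_lin sf sF sG) sh.
rewrite (der_lie sE (fsm_lin sf sF sG) sh).
have sEh := sfun_der sE sh; have sFh := sfun_der sF sh; have sGh := sfun_der sG sh.
rewrite (@der_eq _ _ _ p E _ (fun q => f q * der F h q + der G h q)); last first.
  by have := near_sfun sh; apply: filterS => q shq; exact: der_lin.
rewrite (derD _ (sfunM sf sFh) sGh) (derM _ sf sFh).
rewrite (@der_lin _ _ _ p (f p) (fun q => f q *: F q + G q) F G _ sEh erefl).
rewrite (@der_lin _ _ _ p (f p) (fun q => f q *: lie E F q
  + (der E f q *: F q + lie E G q)) (lie E F)
  (fun q => der E f q *: F q + lie E G q) h sh erefl).
rewrite (@der_lin _ _ _ p (der E f p)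
  (fun q => der E f q *: F q + lie E G q) F (lie E G) h sh erefl).
rewrite (der_lie sE sF sh) (der_lie sE sG sh).
move: (der _ _ p) (der E (der F h) p) (der _ (der E h) p) (der F h p)
  (der _ (der E h) p) (der E (der G h) p) => x1 x2 x3 x4 x5 x6; ring.
Qed.

Lemma lie_linl p E F G f : fsm p E -> fsm p F -> fsm p G -> sfun p f ->
  lie (fun q => f q *: E q + G q) F p
  = f p *: lie E F p - der F f p *: E p + lie G F p.
Proof.
move=> sE sF sG sf; rewrite lieC (lie_linr sF sE sG sf).
by rewrite [lie F E p]lieC [lie F G p]lieC !opprD !opprK scalerN
  opprK addrA.
Qed.

Lemma lieDr p E F G : fsm p E -> fsm p F -> fsm p G ->
  lie E (fun q => F q + G q) p = lie E F p + lie E G p.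
Proof.
move=> sE sF sG; have s1 : sfun p (fun=> 1) := sfun_cst p 1.
have := lie_linr sE sF sG s1; rewrite der_cst scale0r add0r scale1r => <-.
congr (lie E _ p); apply/funext => q; by rewrite scale1r.
Qed.

Lemma lie0r p E : fsm p E -> lie E (fun=> 0) p = 0.
Proof.
move=> sE; have s0 := fsm0 p; have := lieDr sE s0 s0.
have -> : (fun q : M => (0 : 'rV[R]_m) + 0) = (fun=> 0).
  by apply/funext => q; rewrite addr0.
by move/(congr1 (fun z => z - lie E (fun=> 0) p)); rewrite addrK subrr => <-.
Qed.

(** Needed for d(d eta_a) = 0 in the 3-Sasakian case. *)
Lemma lie_jacobi p E F G : fsm p E -> fsm p F -> fsm p G ->
  lie (lie E F) G p + lie (lie F G) E p
  + lie (lie G E) F p = 0.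
Proof.
move=> sE sF sG.
have sEF := fsm_lie sE sF; have sFG := fsm_lie sF sG.
have sGE := fsm_lie sG sE.
apply: (@der_inj _ _ _ p (fun q => lie (lie E F) G q
  + lie (lie F G) E q + lie (lie G E) F q) (fun=> 0)) => h sh.
rewrite (@der_lin _ _ _ p 1 _ (lie (lie E F) G) (fun q =>
  lie (lie F G) E q + lie (lie G E) F q) h sh); last first.
  by rewrite scale1r addrA.
rewrite (@der_lin _ _ _ p 1 (fun q => lie (lie F G) E q + lie (lie G E) F q)
  (lie (lie F G) E) (lie (lie G E) F) h sh); last by rewrite scale1r.
(* Writing 0 as -1 times 0 plus 0 turns the derivative along the zero field into -x + x. *)
rewrite (@der_lin _ _ _ p (-1) (fun=> 0) (fun=> 0) (fun=> 0) h sh); last first.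
  by rewrite scaler0 addr0.
rewrite (der_lie sEF sG sh) (der_lie sFG sE sh) (der_lie sGE sF sh).
have D (X Y Z : field M) : fsm p X -> fsm p Y -> fsm p Z ->
    der X (der (lie Y Z) h) p
    = der X (der Y (der Z h)) p - der X (der Z (der Y h)) p.
  move=> sX sY sZ.
  rewrite -(derB _ (sfun_der sY (sfun_der sZ sh)) (sfun_der sZ (sfun_der sY sh))).
  apply: der_eq; have nY := near_fsm sY; have nZ := near_fsm sZ.
  have nh := near_sfun sh; near=> q.
  have sYq : fsm q Y by exact: (near nY q).
  have sZq : fsm q Z by exact: (near nZ q).
  have shq : sfun q h by exact: (near nh q).
  by rewrite (der_lie sYq sZq shq).
rewrite (D _ _ _ sG sE sF) (D _ _ _ sE sF sG) (D _ _ _ sF sG sE).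
have sEh := sfun_der sE sh; have sFh := sfun_der sF sh; have sGh := sfun_der sG sh.
rewrite (der_lie sE sF sGh) (der_lie sF sG sEh) (der_lie sG sE sFh).
ring.
Unshelve. all: by end_near. Qed.

End LieBracket.

(** * The Levi-Civita connection *)

Section Tensors.
Variables (R : realType) (m : nat) (M : smoothManifold R m).
Implicit Types (c : chart R m M) (p q : M) (f h : M -> R)
  (X Y Z E F G : field M).

Lemma sfun_cod c p f : atlas c -> chart_dom c p ->
  smooth_on (chart_cod c) (rep c f) -> sfun p f.
Proof.
move=> ac cp sf; rewrite sfunE; exists c; first by split.
exists (chart_cod c); last exact: sf.
by split; [exact: chart_cod_open|exists p].
Qed.

Lemma sfun_form1 p (eta : form1 M) E : smooth_form1 eta -> fsm p E ->
  sfun p (fun q => eta q (E q)).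
Proof.
move=> se sE; have ac := chart_at_atlas p; have cp := chart_at_dom p.
have H : sfun p (fun q => \sum_i coord (chart_at p) q (E q) 0 i
                                * eta q (frame (chart_at p) i q)).
  apply: sfun_sum => i; apply: sfunM; first exact: (fsm_comp _ ac cp).1 sE i.
  exact: (sfun_cod ac cp (se _ _ ac)).
apply: sfun_eq H; have ncp := near_chart_dom cp.
near=> q; have cq : chart_dom (chart_at p) q by exact: (near ncp q).
rewrite [in RHS](frame_sum (E q) ac cq) linear_sum; apply: eq_bigr => i _.
by rewrite linearZ.
Unshelve. all: by end_near. Qed.

Lemma fsm_tensor11 p (phi : tensor11 M) E : smooth_tensor11 phi -> fsm p E ->
  fsm p (fun q => phi q (E q)).
Proof.
move=> se sE; have ac := chart_at_atlas p; have cp := chart_at_dom p.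
have H : fsm p (fun q => \sum_i coord (chart_at p) q (E q) 0 i
                                *: phi q (frame (chart_at p) i q)).
  apply: fsm_sum => i; apply: fsmZ; first exact: (fsm_comp _ ac cp).1 sE i.
  rewrite fsmE; exists (chart_at p); first by split.
  exists (chart_cod (chart_at p)); last exact: se _ _ ac.
  by split; [exact: chart_cod_open|exists p].
apply: fsm_eq H; have ncp := near_chart_dom cp.
near=> q; have cq : chart_dom (chart_at p) q by exact: (near ncp q).
rewrite [in RHS](frame_sum (E q) ac cq) linear_sum; apply: eq_bigr => i _.
by rewrite linearZ.
Unshelve. all: by end_near. Qed.

(** The field has constant coordinates in the preferred chart at p; it is smooth near p only, which
    is enough to test identities between local objects. *)
Lemma field_ext p (w : 'rV[R]_m) : exists2 Z, fsm p Z & Z p = w.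
Proof.
have ac := chart_at_atlas p; have cp := chart_at_dom p.
exists (fun q => \sum_i coord (chart_at p) p w 0 i *: frame (chart_at p) i q).
  apply: fsm_sum => i; apply: fsmZ; first exact: sfun_cst.
  exact: fsm_frame.
by rewrite -(frame_sum w ac cp).
Qed.

End Tensors.

(** * The metric, Koszul's expression and the Gram matrix *)

Section Metric.
Variables (R : realType) (m : nat) (M : smoothManifold R m).
Variable g : riemannian_metric M.
Implicit Types (c : chart R m M) (p q : M) (f h : M -> R)
  (X Y Z E F G : field M) (u v w : 'rV[R]_m).

Lemma metric_linl p (a : R) u v w :
  g p (a *: u + v) w = a * g p u w + g p v w.
Proof. exact: metric_linear. Qed.

Lemma metric_linr p (a : R) u v w :
  g p w (a *: u + v) = a * g p w u + g p w v.
Proof. by rewrite metric_sym metric_linl !(metric_sym g _ w). Qed.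

Lemma metric0l p w : g p 0 w = 0.
Proof. by have := metric_linl p (-1) 0 0 w; rewrite scaler0 addr0; lra. Qed.

Lemma metric0r p w : g p w 0 = 0.
Proof. by rewrite metric_sym metric0l. Qed.

Lemma metricDl p u v w : g p (u + v) w = g p u w + g p v w.
Proof. by have := metric_linl p 1 u v w; rewrite scale1r mul1r. Qed.

Lemma metricDr p u v w : g p w (u + v) = g p w u + g p w v.
Proof. by rewrite metric_sym metricDl !(metric_sym g _ w). Qed.

Lemma metricZl p a u w : g p (a *: u) w = a * g p u w.
Proof. by have := metric_linl p a u 0 w; rewrite !addr0 metric0l addr0. Qed.

Lemma metricZr p a u w : g p w (a *: u) = a * g p w u.
Proof. by rewrite metric_sym metricZl metric_sym. Qed.

Lemma metricNl p u w : g p (- u) w = - g p u w.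
Proof. by rewrite -scaleN1r metricZl mulN1r. Qed.

Lemma metricNr p u w : g p w (- u) = - g p w u.
Proof. by rewrite metric_sym metricNl metric_sym. Qed.

Lemma metric_suml p (I : Type) (r : seq I) (u : I -> 'rV[R]_m) w :
  g p (\sum_(i <- r) u i) w = \sum_(i <- r) g p (u i) w.
Proof.
elim: r => [|i r IH]; first by rewrite !big_nil metric0l.
by rewrite !big_cons metricDl IH.
Qed.

Lemma metric_sumr p (I : Type) (r : seq I) (u : I -> 'rV[R]_m) w :
  g p w (\sum_(i <- r) u i) = \sum_(i <- r) g p w (u i).
Proof.
by rewrite metric_sym metric_suml; apply: eq_bigr => i _; exact: metric_sym.
Qed.

Lemma metric_inj p u v : (forall w, g p u w = g p v w) -> u = v.
Proof.
move=> uv; apply/eqP; rewrite -subr_eq0; apply/negP => /negP d0.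
by have := metric_pos g p d0; rewrite metricDl metricNl uv subrr ltxx.
Qed.

Lemma metric_field_inj p u v :
  (forall Z, fsm p Z -> g p u (Z p) = g p v (Z p)) -> u = v.
Proof.
by move=> uv; apply: (@metric_inj p) => w; have [Z sZ <-] := field_ext p w; exact: uv.
Qed.

Definition mf E F : M -> R := fun q => g q (E q) (F q).

Lemma mfC E F : mf E F = mf F E.
Proof. by apply/funext => q; exact: metric_sym. Qed.

Lemma sfun_mf p E F : fsm p E -> fsm p F -> sfun p (mf E F).
Proof.
move=> sE sF; have ac := chart_at_atlas p; have cp := chart_at_dom p.
have H : sfun p (fun q => \sum_i \sum_j
   coord (chart_at p) q (E q) 0 i * (coord (chart_at p) q (F q) 0 j *
   g q (frame (chart_at p) i q) (frame (chart_at p) j q))).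
  apply: sfun_sum => i; apply: sfun_sum => j.
  apply: sfunM; first exact: (fsm_comp _ ac cp).1 sE i.
  apply: sfunM; first exact: (fsm_comp _ ac cp).1 sF j.
  exact: (sfun_cod ac cp (@metric_smooth _ _ _ g _ _ _ ac)).
apply: sfun_eq H; have ncp := near_chart_dom cp.
near=> q; have cq : chart_dom (chart_at p) q by exact: (near ncp q).
rewrite /mf [in RHS](frame_sum (E q) ac cq) metric_suml; apply: eq_bigr => i _.
rewrite metricZl -mulr_sumr; congr (_ * _).
rewrite [in RHS](frame_sum (F q) ac cq) metric_sumr; apply: eq_bigr => j _.
by rewrite metricZr.
Unshelve. all: by end_near. Qed.

Lemma der_mf_lin p X f E F G : sfun p f -> fsm p E -> fsm p F -> fsm p G ->
  der X (mf (fun q => f q *: E q + F q) G) p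
  = f p * der X (mf E G) p + der X f p * g p (E p) (G p) + der X (mf F G) p.
Proof.
move=> sf sE sF sG; have sEG := sfun_mf sE sG; have sFG := sfun_mf sF sG.
have -> : mf (fun q => f q *: E q + F q) G = (fun q => f q * mf E G q + mf F G q).
  by apply/funext => q; rewrite /mf metric_linl.
by rewrite (derD _ (sfunM sf sEG) sFG) (derM _ sf sEG).
Qed.

(* Twice g(nabla_E F, Z), by Koszul's formula. *)
Definition kos E F Z p : R :=
  der E (mf F Z) p + der F (mf E Z) p - der Z (mf E F) p
  + g p (lie E F p) (Z p) - g p (lie E Z p) (F p) - g p (lie F Z p) (E p).

Lemma sfun_kos p E F Z : fsm p E -> fsm p F -> fsm p Z -> sfun p (kos E F Z).
Proof.
move=> sE sF sZ.
have L (A B C : field M) : fsm p A -> fsm p B -> fsm p C ->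
    sfun p (fun q => g q (lie A B q) (C q)).
  by move=> sA sB sC; exact: (sfun_mf (fsm_lie sA sB) sC).
have D (A B C : field M) : fsm p A -> fsm p B -> fsm p C ->
    sfun p (der A (mf B C)).
  by move=> sA sB sC; exact: (sfun_der sA (sfun_mf sB sC)).
exact: (sfunB (sfunB (sfunD (sfunB (sfunD (D _ _ _ sE sF sZ) (D _ _ _ sF sE sZ))
  (D _ _ _ sZ sE sF)) (L _ _ _ sE sF sZ)) (L _ _ _ sE sZ sF)) (L _ _ _ sF sZ sE)).
Qed.

(** Locality in Z: the expansion of Z in coordinate fields holds only on the domain of the chart,
    while Koszul's expression differentiates Z. *)
Lemma kos_eqZ p E F Z Z' : fsm p E -> fsm p F -> fsm p Z ->
  (\forall q \near p, Z q = Z' q) -> kos E F Z p = kos E F Z' p.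
Proof.
move=> sE sF sZ ZZ'; rewrite /kos (lie_eqr sE sZ ZZ') (lie_eqr sF sZ ZZ').
rewrite (nbhs_singleton ZZ') (der_at (mf E F) (nbhs_singleton ZZ')).
have H X Y : der X (mf Y Z) p = der X (mf Y Z') p.
  by apply: der_eq; apply: filterS ZZ' => q; rewrite /mf => ->.
by rewrite (H E F) (H F E).
Qed.

(** The derivatives of f produced by the metric terms and by the brackets cancel. Being linear over
    functions in Z, Koszul's expression is represented by a vector. *)
Lemma kos_linZ p E F Z Z' f : sfun p f ->
  fsm p E -> fsm p F -> fsm p Z -> fsm p Z' ->
  kos E F (fun q => f q *: Z q + Z' q) p = f p * kos E F Z p + kos E F Z' p.
Proof.
move=> sf sE sF sZ sZ'; rewrite /kos (mfC F) (mfC E (fun q => _ + _)).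
rewrite (der_mf_lin E sf sZ sZ' sF) (der_mf_lin F sf sZ sZ' sE).
rewrite (lie_linr sE sZ sZ' sf) (lie_linr sF sZ sZ' sf).
rewrite (@der_lin _ _ _ p (f p) (fun q => f q *: Z q + Z' q)
  Z Z' _ (sfun_mf sE sF) erefl).
rewrite !metric_linl metric_linr (mfC Z E) (mfC Z F) (mfC Z' E) (mfC Z' F).
ring.
Qed.

Lemma kos_linE p E E' F Z f : sfun p f ->
  fsm p E -> fsm p E' -> fsm p F -> fsm p Z ->
  kos (fun q => f q *: E q + E' q) F Z p = f p * kos E F Z p + kos E' F Z p.
Proof.
move=> sf sE sE' sF sZ; rewrite /kos.
rewrite (der_mf_lin F sf sE sE' sZ) (der_mf_lin Z sf sE sE' sF).
rewrite (lie_linl sE sF sE' sf) (lie_linl sE sZ sE' sf).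
rewrite (@der_lin _ _ _ p (f p) (fun q => f q *: E q + E' q)
  E E' _ (sfun_mf sF sZ) erefl).
rewrite !metricDl !metricNl !metricZl metric_linr (metric_sym g p (E p) (F p)).
rewrite (metric_sym g p (E p) (Z p)).
ring.
Qed.

(** Here the derivatives of f along E add up instead of cancelling: they give the Leibniz term of
    nabla_E (f F), doubled like everything else in Koszul's formula. *)
Lemma kos_linF p E F F' Z f : sfun p f ->
  fsm p E -> fsm p F -> fsm p F' -> fsm p Z ->
  kos E (fun q => f q *: F q + F' q) Z p
  = f p * kos E F Z p + kos E F' Z p + 2 * (der E f p * g p (F p) (Z p)).
Proof.
move=> sf sE sF sF' sZ; rewrite /kos (mfC E (fun q => _ + _)).
rewrite (der_mf_lin E sf sF sF' sZ) (der_mf_lin Z sf sF sF' sE).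
rewrite (lie_linr sE sF sF' sf) (lie_linl sF sZ sF' sf).
rewrite (@der_lin _ _ _ p (f p) (fun q => f q *: F q + F' q)
  F F' _ (sfun_mf sE sZ) erefl).
rewrite !metricDl !metricNl !metricZl metric_linr (mfC E F) (mfC E F').
rewrite (metric_sym g p (F p) (E p)).
ring.
Qed.

(** Source of the vanishing torsion of [lc]; [kos_metric] is likewise the source of its
    compatibility with g. *)
Lemma kos_skew p E F Z :
  kos E F Z p - kos F E Z p = 2 * g p (lie E F p) (Z p).
Proof.
rewrite /kos (mfC F E) (lieC p F E) metricNl; ring.
Qed.

Lemma kos_metric p G E F : kos G E F p + kos G F E p = 2 * der G (mf E F) p.
Proof.
rewrite /kos (mfC F E) (lieC p F E) metricNl; ring.
Qed.

Lemma kos_sumZ p E F (I : Type) (r : seq I) (f : I -> M -> R) (Z : I -> field M) :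
  fsm p E -> fsm p F -> (forall i, sfun p (f i)) -> (forall i, fsm p (Z i)) ->
  kos E F (fun q => \sum_(i <- r) f i q *: Z i q) p
  = \sum_(i <- r) f i p * kos E F (Z i) p.
Proof.
move=> sE sF sf sZ.
elim: r => [|i r IH].
  rewrite big_nil.
  have s0 := fsm0 p; have := kos_linZ (sfun_cst p (-1)) sE sF s0 s0.
  have -> : (fun q : M => (-1 : R) *: (0 : 'rV[R]_m) + 0) = (fun=> 0).
    by apply/funext => q; rewrite scaler0 addr0.
  have -> : (fun q => \sum_(i <- [::]) f i q *: Z i q) = (fun=> 0).
    by apply/funext => q; rewrite big_nil.
  by lra.
have -> : (fun q => \sum_(i <- i :: r) f i q *: Z i q)
   = (fun q => f i q *: Z i q + \sum_(i <- r) f i q *: Z i q).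
  by apply/funext => q; rewrite big_cons.
rewrite big_cons (kos_linZ (sf i) sE sF (sZ i)) ?IH //.
by apply: fsm_sum => j; exact: fsmZ.
Qed.

Definition gram c p : 'M[R]_m := \matrix_(i, j) g p (frame c i p) (frame c j p).

Lemma mul_gram c p v j : atlas c -> chart_dom c p ->
  (coord c p v *m gram c p) 0 j = g p v (frame c j p).
Proof.
move=> ac cp; rewrite [in RHS](frame_sum v ac cp) metric_suml mxE.
by apply: eq_bigr => i _; rewrite metricZl mxE.
Qed.

(** A row in the kernel is the coordinate row of a tangent vector orthogonal to a whole frame, hence
    zero since g is positive definite. *)
Lemma gram_unit c p : atlas c -> chart_dom c p -> gram c p \in unitmx.
Proof.
move=> ac cp; rewrite -row_free_unit; apply: inj_row_free => u u0.
have : vect c p u = 0.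
  apply: (@metric_inj p) => w; rewrite metric0l (frame_sum w ac cp) metric_sumr.
  rewrite big1 // => j _; rewrite metricZr -(mul_gram _ j ac cp) vectK //.
  by rewrite u0 mxE mulr0.
by move/(congr1 (coord c p)); rewrite vectK // coord0.
Qed.

(** Cramer's rule: the entries are cofactors divided by a determinant that does not vanish at p. *)
Lemma sfun_gram_inv c p i j : atlas c -> chart_dom c p ->
  sfun p (fun q => invmx (gram c q) i j).
Proof.
move=> ac cp.
have sG (k l : 'I_m) : sfun p (fun q => gram c q k l).
  have := sfun_mf (fsm_frame k ac cp) (fsm_frame l ac cp).
  by apply: sfun_eq; near=> q; rewrite mxE.
have sD := sfun_det sG.
have D0 : \det (gram c p) != 0.
  by have := gram_unit ac cp; rewrite unitmxE unitfE.
have sC : sfun p (fun q => cofactor (gram c q) j i).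
  apply: sfunM; first exact: sfun_cst.
  apply: sfun_det => k l.
  by apply: sfun_eq (sG (lift j k) (lift i l)); near=> q; rewrite !mxE.
apply: sfun_eq (sfunM (sfunV D0 sD) sC); have ncp := near_chart_dom cp.
near=> q; have cq : chart_dom c q by exact: (near ncp q).
by rewrite /invmx (gram_unit ac cq) !mxE.
Unshelve. all: by end_near. Qed.

End Metric.

HB.lock Definition lc (R : realType) (m : nat) (M : smoothManifold R m)
    (g : riemannian_metric M) (E F : field M) : field M := fun p =>
  let c := chart_at p in
  vect c p (2^-1 *: (\row_i kos g E F (frame c i) p *m invmx (gram g c p))).

(** * Properties of the connection defined by Koszul's formula *)

Section LeviCivita.
Variables (R : realType) (m : nat) (M : smoothManifold R m).
Variable g : riemannian_metric M.
Implicit Types (c : chart R m M) (p q : M) (f h : M -> R)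
  (X Y Z E F G : field M) (u v w : 'rV[R]_m).

Local Notation mf := (mf g).
Local Notation kos := (kos g).
Local Notation gram := (gram g).
Local Notation lc := (lc g).

Lemma lc_koszul p E F Z : fsm p E -> fsm p F -> fsm p Z ->
  2 * g p (lc E F p) (Z p) = kos E F Z p.
Proof.
move=> sE sF sZ; have ac := chart_at_atlas p; have cp := chart_at_dom p.
set c := chart_at p in ac cp *.
have sZi (i : 'I_m) : sfun p (fun q => coord c q (Z q) 0 i).
  exact: (fsm_comp _ ac cp).1 sZ i.
have sFr (i : 'I_m) : fsm p (frame c i) by exact: fsm_frame.
have := kos_sumZ g (index_enum 'I_m) sE sF sZi sFr.
rewrite -(@kos_eqZ _ _ _ g p E F Z); [|exact: sE|exact: sF|exact: sZ|]; last first.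
  by have := near_chart_dom cp; apply: filterS => q cq; exact: frame_sum.
move=> ->; rewrite {1}(frame_sum (Z p) ac cp) metric_sumr mulr_sumr.
apply: eq_bigr => j _; rewrite metricZr -(mul_gram g _ j ac cp) lc.unlock -/c vectK //.
rewrite -scalemxAl mulmxKV ?gram_unit // !mxE.
by rewrite mulrCA mulVKf // pnatr_eq0.
Qed.

(** The definition of [lc] uses the preferred chart of each point, which may jump from point to
    point. [lc_koszul] characterises the value without a chart, so near p all values can be computed
    in the single chart fixed at p. *)
Lemma fsm_lc p E F : fsm p E -> fsm p F -> fsm p (lc E F).
Proof.
move=> sE sF; have ac := chart_at_atlas p; have cp := chart_at_dom p.
set c := chart_at p in ac cp *.
apply/(fsm_comp _ ac cp) => j.
have H : sfun p (fun q => \sum_i 2^-1 * (kos E F (frame c i) q * invmx (gram c q) i j)).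
  apply: sfun_sum => i; apply: sfunM; first exact: sfun_cst.
  apply: sfunM; first by apply: sfun_kos => //; exact: fsm_frame.
  exact: sfun_gram_inv.
apply: sfun_eq H; have ncp := near_chart_dom cp.
have nE := near_fsm sE; have nF := near_fsm sF.
near=> q; have cq : chart_dom c q by exact: (near ncp q).
have sEq : fsm q E by exact: (near nE q).
have sFq : fsm q F by exact: (near nF q).
have -> : coord c q (lc E F q)
    = (2^-1 *: \row_i kos E F (frame c i) q) *m invmx (gram c q).
  apply/eqP; rewrite -(inj_eq (can_inj (mulmxK (gram_unit g ac cq)))).
  rewrite mulmxKV ?gram_unit //; apply/eqP/rowP => i.
  rewrite (mul_gram g _ i ac cq) !mxE -(lc_koszul sEq sFq (fsm_frame i ac cq)).
  by rewrite mulKf // pnatr_eq0.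
by rewrite mxE; apply: eq_bigr => i _; rewrite !mxE mulrA.
Unshelve. all: by end_near. Qed.

Lemma lc_inj p E F u : fsm p E -> fsm p F ->
  (forall Z, fsm p Z -> 2 * g p u (Z p) = kos E F Z p) -> lc E F p = u.
Proof.
move=> sE sF H; apply: (@metric_field_inj _ _ _ g p) => Z sZ.
by have := lc_koszul sE sF sZ; rewrite -H // => /mulfI; apply; rewrite pnatr_eq0.
Qed.

Lemma lc_linl p E E' F f : sfun p f -> fsm p E -> fsm p E' -> fsm p F ->
  lc (fun q => f q *: E q + E' q) F p = f p *: lc E F p + lc E' F p.
Proof.
move=> sf sE sE' sF; have sEE := fsm_lin sf sE sE'.
apply: (lc_inj sEE sF) => Z sZ.
rewrite (kos_linE g sf sE sE' sF sZ) metric_linl -(lc_koszul sE sF sZ).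
rewrite -(lc_koszul sE' sF sZ); ring.
Qed.

Lemma lc_linr p E F F' f : sfun p f -> fsm p E -> fsm p F -> fsm p F' ->
  lc E (fun q => f q *: F q + F' q) p
  = f p *: lc E F p + der E f p *: F p + lc E F' p.
Proof.
move=> sf sE sF sF'; have sFF := fsm_lin sf sF sF'.
apply: (lc_inj sE sFF) => Z sZ.
rewrite (kos_linF g sf sE sF sF' sZ) !metricDl !metricZl -(lc_koszul sE sF sZ).
rewrite -(lc_koszul sE sF' sZ); ring.
Qed.

Lemma lc_torsion p E F : fsm p E -> fsm p F ->
  lc E F p - lc F E p = lie E F p.
Proof.
move=> sE sF; apply: (@metric_field_inj _ _ _ g p) => Z sZ; rewrite metricDl metricNl.
have := kos_skew g p E F Z; rewrite -(lc_koszul sE sF sZ) -(lc_koszul sF sE sZ).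
by lra.
Qed.

Lemma lc_metric p G E F : fsm p G -> fsm p E -> fsm p F ->
  der G (mf E F) p = g p (lc G E p) (F p) + g p (E p) (lc G F p).
Proof.
move=> sG sE sF; have := kos_metric g p G E F.
rewrite -(lc_koszul sG sE sF) -(lc_koszul sG sF sE).
by rewrite (metric_sym g p (E p)); lra.
Qed.

End LeviCivita.

(** * Connections and the algebra of three structures *)

Section Connections.
Variables (R : realType) (m : nat) (M : smoothManifold R m).
Variable g : riemannian_metric M.
Implicit Types (p q : M) (f h : M -> R) (X Y Z E F G : field M).

Lemma smooth_fsm X p : smooth_field X -> fsm p X.
Proof. by move/smooth_fieldP; exact. Qed.

Lemma smooth_sfun f p : smooth_fun f -> sfun p f.
Proof. by move/smooth_funP; exact. Qed.

Lemma lc0r p E : fsm p E -> lc g E (fun=> 0) p = 0.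
Proof.
move=> sE; have s0 := fsm0 p.
apply: (lc_inj sE s0) => Z sZ; rewrite metric0l mulr0.
have := kos_linF g (sfun_cst p (-1)) sE s0 s0 sZ.
have -> : (fun q : M => (-1 : R) *: (0 : 'rV[R]_m) + 0) = (fun=> 0).
  by apply/funext => q; rewrite scaler0 addr0.
by rewrite metric0l; lra.
Qed.

Lemma lcD p E F F' : fsm p E -> fsm p F -> fsm p F' ->
  lc g E (fun q => F q + F' q) p = lc g E F p + lc g E F' p.
Proof.
move=> sE sF sF'; have := lc_linr g (sfun_cst p 1) sE sF sF'.
rewrite der_cst scale0r addr0 scale1r => <-; congr (lc g E _ p).
by apply/funext => q; rewrite scale1r.
Qed.

Lemma lcZ p E F f : fsm p E -> fsm p F -> sfun p f ->
  lc g E (fun q => f q *: F q) p = f p *: lc g E F p + der E f p *: F p.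
Proof.
move=> sE sF sf; have := lc_linr g sf sE sF (fsm0 p).
rewrite lc0r // addr0 => <-; congr (lc g E _ p).
by apply/funext => q; rewrite addr0.
Qed.

Lemma lcN p E F : fsm p E -> fsm p F ->
  lc g E (fun q => - F q) p = - lc g E F p.
Proof.
move=> sE sF; have := lcZ sE sF (sfun_cst p (-1)).
rewrite der_cst scale0r addr0 scaleN1r => <-; congr (lc g E _ p).
by apply/funext => q; rewrite scaleN1r.
Qed.

Lemma lc_linear_connection : linear_connection (lc g).
Proof.
split.
- move=> E F sE sF; apply/smooth_fieldP => p.
  exact: (fsm_lc g (smooth_fsm p sE) (smooth_fsm p sF)).
- move=> f E E' F sf sE sE' sF p.
  exact: (lc_linl g (smooth_sfun p sf) (smooth_fsm p sE) (smooth_fsm p sE')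
    (smooth_fsm p sF)).
- move=> E F F' sE sF sF' p.
  exact: (lcD (smooth_fsm p sE) (smooth_fsm p sF) (smooth_fsm p sF')).
- move=> f E F sf sE sF p; rewrite act_der.
  exact: (lcZ (smooth_fsm p sE) (smooth_fsm p sF) (smooth_sfun p sf)).
Qed.

Lemma lc_levi_civita : levi_civita g (lc g).
Proof.
split; first exact: lc_linear_connection.
  move=> E F sE sF p; rewrite /torsion bracket_lie.
  by rewrite (lc_torsion g (smooth_fsm p sE) (smooth_fsm p sF)) subrr.
move=> G E F sG sE sF p; rewrite /cov_form2 act_der.
rewrite [der _ _ _](lc_metric g (smooth_fsm p sG) (smooth_fsm p sE) (smooth_fsm p sF)).
by rewrite addrAC addrK subrr.
Qed.

(** In the 3-cosymplectic case [canon] and [lc] are shown to agree on smooth fields; the axioms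
    evaluate a connection on such fields only, so they transfer. *)
Lemma linear_connection_eq (D D' : field M -> field M -> field M) :
  (forall E F, smooth_field E -> smooth_field F -> D' E F = D E F) ->
  linear_connection D -> linear_connection D'.
Proof.
move=> DD [cs cl ca cz]; split.
- by move=> E F sE sF; rewrite (DD _ _ sE sF); exact: cs.
- move=> f E E' F sf sE sE' sF p.
  have sEE : smooth_field (fun q => f q *: E q + E' q).
    by apply/smooth_fieldP => q; exact: (fsm_lin (smooth_sfun q sf)
      (smooth_fsm q sE) (smooth_fsm q sE')).
  rewrite (DD _ _ sEE sF) (DD _ _ sE sF) (DD _ _ sE' sF).
  exact: (cl _ _ _ _ sf sE sE' sF).
- move=> E F F' sE sF sF' p.
  have sFF : smooth_field (fun q => F q + F' q).
    by apply/smooth_fieldP => q; exact: (fsmD (smooth_fsm q sF) (smooth_fsm q sF')).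
  rewrite (DD _ _ sE sFF) (DD _ _ sE sF) (DD _ _ sE sF'); exact: (ca _ _ _ sE sF sF').
- move=> f E F sf sE sF p.
  have sfF : smooth_field (fun q => f q *: F q).
    by apply/smooth_fieldP => q; exact: (fsmZ (smooth_sfun q sf) (smooth_fsm q sF)).
  rewrite (DD _ _ sE sfF) (DD _ _ sE sF); exact: (cz _ _ _ sf sE sF).
Qed.

Lemma levi_civita_eq (D D' : field M -> field M -> field M) :
  (forall E F, smooth_field E -> smooth_field F -> D' E F = D E F) ->
  levi_civita g D -> levi_civita g D'.
Proof.
move=> DD [cD tD mD]; split; first exact: linear_connection_eq cD.
  by move=> E F sE sF p; rewrite /torsion !DD //; exact: tD.
by move=> G E F sG sE sF p; rewrite /cov_form2 !DD //; exact: mD.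
Qed.

(** The trailing summand E' supplies the base case of the induction, which therefore never evaluates
    D on the zero field. *)
Lemma connection_sum (D : field M -> field M -> field M) (I : Type) (r : seq I)
    (f : I -> M -> R) (E : I -> field M) E' F p : linear_connection D ->
  (forall i, smooth_fun (f i)) -> (forall i, smooth_field (E i)) ->
  smooth_field E' -> smooth_field F ->
  D (fun q => \sum_(i <- r) f i q *: E i q + E' q) F p
  = \sum_(i <- r) f i p *: D (E i) F p + D E' F p.
Proof.
move=> [_ cl _ _] sf sE sE' sF; elim: r => [|i r IH].
  rewrite big_nil add0r; congr (D _ F p).
  by apply/funext => q; rewrite big_nil add0r.
have -> : (fun q => \sum_(i <- i :: r) f i q *: E i q + E' q)
   = (fun q => f i q *: E i q + (\sum_(i <- r) f i q *: E i q + E' q)).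
  by apply/funext => q; rewrite big_cons addrA.
rewrite big_cons -addrA -IH; apply: (cl _ _ _ _ (sf i) (sE i) _ sF).
apply/smooth_fieldP => q; apply: fsmD; last exact: smooth_fsm.
apply: fsm_sum => j; exact: (fsmZ (smooth_sfun q (sf j)) (smooth_fsm q (sE j))).
Qed.

Lemma connection_sum_parallel (D : field M -> field M -> field M) (I : Type)
    (r : seq I) (f : I -> M -> R) (X : I -> field M) E F p :
  linear_connection D -> (forall i, smooth_fun (f i)) ->
  (forall i, smooth_field (X i)) -> (forall i, D E (X i) p = 0) ->
  smooth_field E -> smooth_field F ->
  D E (fun q => \sum_(i <- r) f i q *: X i q + F q) p
  = \sum_(i <- r) der E (f i) p *: X i p + D E F p.
Proof.
move=> [_ _ ca cz] sf sX X0 sE sF; elim: r => [|i r IH].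
  rewrite big_nil add0r; congr (D E _ p).
  by apply/funext => q; rewrite big_nil add0r.
have -> : (fun q => \sum_(i <- i :: r) f i q *: X i q + F q)
   = (fun q => f i q *: X i q + (\sum_(i <- r) f i q *: X i q + F q)).
  by apply/funext => q; rewrite big_cons addrA.
have sfX j : smooth_field (fun q => f j q *: X j q).
  by apply/smooth_fieldP => q; exact: (fsmZ (smooth_sfun q (sf j)) (smooth_fsm q (sX j))).
rewrite big_cons -addrA -IH (ca _ _ _ sE (sfX i)).
  by rewrite (cz _ _ _ (sf i) sE (sX i)) X0 scaler0 add0r act_der.
apply/smooth_fieldP => q; apply: fsmD; last exact: smooth_fsm.
by apply: fsm_sum => j; exact: (smooth_fsm q (sfX j)).
Qed.

End Connections.

(** * The totally antisymmetric symbol *)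

Section Eps.
Variable R : realType.
Implicit Types a b c : 'I_3.

Lemma eps_cycle a b c : eps R c a b = eps R a b c.
Proof. by rewrite /eps; ring. Qed.

Lemma eps_swap a b c : eps R a c b = - eps R a b c.
Proof. by rewrite /eps; ring. Qed.

Lemma eps_diag a c : eps R a a c = 0.
Proof. by rewrite /eps subrr !mul0r. Qed.

(** Isolates one term: with this c, the sum expressing phi_a xi_c reduces to a nonzero multiple of
    xi_b. *)
Lemma eps_third a b : a != b -> exists2 c,
  eps R a c b != 0 & forall d, d != b -> eps R a c d = 0.
Proof.
move=> ab; exists (inord (3 - a - b)).
  rewrite /eps.
  case: a ab => [[|[|[|//]]] ?]; case: b => [[|[|[|//]]] ?] //= _;
    rewrite inordK //= !(subSS, subn0, subnn); apply/eqP => H; lra.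
move=> d; rewrite /eps.
case: a ab => [[|[|[|//]]] ?]; case: b => [[|[|[|//]]] ?] //= _;
  case: d => [[|[|[|//]]] ?] //= _;
  rewrite inordK //= !(subSS, subn0, subnn); lra.
Qed.

End Eps.

(** * Pointwise algebra of the three structures *)

Section Algebra3.
Variables (R : realType) (n : nat) (M : smoothManifold R (4 * n).+3).
Variable S : almost_3contact_metric M.
Implicit Types (p q : M) (a b c : 'I_3) (u v w : 'rV[R]_((4 * n).+3)).

Local Notation phi := (phi3 S).
Local Notation xi := (xi3 S).
Local Notation eta := (eta3 S).
Local Notation g := (met3 S).

Lemma phi_xi p a b : phi a p (xi b p) = \sum_c eps R a b c *: xi c p.
Proof. exact: phi_xi3. Qed.

Lemma eta_phi p a b v : eta a p (phi b p v) = \sum_c eps R a b c * eta c p v.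
Proof. exact: eta_phi3. Qed.

Lemma phi_xi_diag p a : phi a p (xi a p) = 0.
Proof. by rewrite phi_xi big1 // => c _; rewrite eps_diag scale0r. Qed.

Lemma eta_phi_diag p a v : eta a p (phi a p v) = 0.
Proof. by rewrite eta_phi big1 // => c _; rewrite eps_diag mul0r. Qed.

Lemma phi_sq p a v : phi a p (phi a p v) = - v + eta a p v *: xi a p.
Proof. exact: ac_phi_sq. Qed.

(** For a != b, let c be the third index: xi_b is a multiple of phi_a xi_c, and eta_a vanishes on
    the image of phi_a. *)
Lemma eta_xi p a b : eta a p (xi b p) = (a == b)%:R.
Proof.
have [<-|ab] := eqVneq a b; first exact: ac_eta_xi.
have [c c0 cd] := eps_third R ab.
have := eta_phi_diag p a (xi c p); rewrite phi_xi (bigD1 b) //= big1 ?addr0.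
  by rewrite linearZ => /eqP; rewrite mulf_eq0 (negbTE c0) => /eqP.
by move=> d /cd ->; rewrite scale0r.
Qed.

Lemma metric_xi p a v : g p (xi a p) v = eta a p v.
Proof.
have := met3_compatible S a p (xi a p) v.
rewrite -/(phi a) phi_xi_diag metric0l (ac_eta_xi (str3 S a)) mul1r.
by move/eqP; rewrite eq_sym subr_eq0 => /eqP.
Qed.

Lemma metric_phi p a u v : g p (phi a p u) v = - g p u (phi a p v).
Proof.
have := met3_compatible S a p u (phi a p v).
rewrite -/(phi a) phi_sq metricDr metricNr metricZr.
rewrite [g p _ (xi a p)]metric_sym metric_xi -/(eta a) !eta_phi_diag !mulr0.
by rewrite addr0 subr0 => <-; rewrite opprK.
Qed.

(** phi_a commutes with the vertical projection, since both sides carry the same antisymmetric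
    coefficients up to a cyclic shift; [phi_hpart] follows. *)
Lemma sum_eta_phi p a v :
  \sum_c eta c p (phi a p v) *: xi c p = \sum_b eta b p v *: phi a p (xi b p).
Proof.
under eq_bigr do rewrite eta_phi scaler_suml.
rewrite exchange_big; apply: eq_bigr => b _ /=.
rewrite phi_xi scaler_sumr; apply: eq_bigr => c _.
by rewrite eps_cycle scalerA mulrC.
Qed.

Lemma eta_hpart p a F : eta a p (hpart S F p) = 0.
Proof.
rewrite /hpart linearB linear_sum (bigD1 a) //= big1 ?addr0.
  by rewrite linearZ [X in _ - _ * X]eta_xi eqxx mulr1 subrr.
by move=> b ba; rewrite linearZ /= -/(eta a) eta_xi eq_sym (negbTE ba) mulr0.
Qed.

Lemma hpart_id F : (forall a p, eta a p (F p) = 0) -> hpart S F = F.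
Proof.
move=> F0; apply/funext => p; rewrite /hpart big1 ?subr0 // => a _.
by rewrite F0 scale0r.
Qed.

Lemma phi_hpart a F :
  (fun p => phi a p (hpart S F p)) = hpart S (fun p => phi a p (F p)).
Proof.
apply/funext => p; rewrite /hpart linearB linear_sum sum_eta_phi.
by congr (_ - _); apply: eq_bigr => b _; rewrite linearZ.
Qed.

Lemma metric_hpart p F v : (forall a, eta a p v = 0) ->
  g p (hpart S F p) v = g p (F p) v.
Proof.
move=> v0; rewrite /hpart metricDl metricNl metric_suml big1 ?subr0 // => a _.
by rewrite metricZl metric_xi v0 mulr0.
Qed.

Lemma hpartE F p : F p = \sum_a eta a p (F p) *: xi a p + hpart S F p.
Proof. by rewrite /hpart addrC subrK. Qed.

Lemma eta_phi_horizontal p a b v : (forall c, eta c p v = 0) ->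
  eta a p (phi b p v) = 0.
Proof. by move=> v0; rewrite eta_phi big1 // => c _; rewrite v0 mulr0. Qed.

Lemma fsm_xi p a : fsm p (xi a).
Proof. apply: smooth_fsm; exact: ac_xi_smooth. Qed.

Lemma fsm_phi p a F : fsm p F -> fsm p (fun q => phi a q (F q)).
Proof. by apply: fsm_tensor11; exact: ac_phi_smooth. Qed.

Lemma sfun_eta p a F : fsm p F -> sfun p (fun q => eta a q (F q)).
Proof. by apply: sfun_form1; exact: ac_eta_smooth. Qed.

Lemma fsm_hpart p F : fsm p F -> fsm p (hpart S F).
Proof.
move=> sF; apply: (fsmB sF); apply: fsm_sum => a.
exact: (fsmZ (sfun_eta a sF) (fsm_xi p a)).
Qed.

End Algebra3.

(** * The canonical connection *)

HB.lock Definition canon (R : realType) (n : nat)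
    (M : smoothManifold R (4 * n).+3) (S : almost_3contact_metric M)
    (E F : field M) : field M := fun p =>
  hpart S (lc (met3 S) (hpart S E) (hpart S F)) p
  + (\sum_a eta3 S a p (E p) *: lie (xi3 S a) (hpart S F) p
     + \sum_b der E (fun q => eta3 S b q (F q)) p *: xi3 S b p).

Section Canonical.
Variables (R : realType) (n : nat) (M : smoothManifold R (4 * n).+3).
Variable S : almost_3contact_metric M.
Implicit Types (p q : M) (a b c : 'I_3) (u v w : 'rV[R]_((4 * n).+3))
  (f : M -> R) (X Y Z E F G : field M).

Local Notation phi := (phi3 S).
Local Notation xi := (xi3 S).
Local Notation eta := (eta3 S).
Local Notation g := (met3 S).
Local Notation canon := (canon S).

(** [hpart] acts on fields; this is the same projector on one tangent space, where its linearity can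
    be applied to values such as that of [lc] at p. *)
Definition hproj p v := v - \sum_a eta a p v *: xi a p.

Lemma hproj_lin p (k : R) u v :
  hproj p (k *: u + v) = k *: hproj p u + hproj p v.
Proof.
have -> : hproj p (k *: u + v) = k *: u + v
    - (k *: (\sum_a eta a p u *: xi a p) + \sum_a eta a p v *: xi a p).
  rewrite /hproj scaler_sumr -big_split; congr (_ - _); apply: eq_bigr => a _ /=.
  by rewrite linearP scalerDl scalerA.
rewrite /hproj; move: (\sum_(a < 3) _) (\sum_(a < 3) _) => x y.
by apply/rowP => i; rewrite !mxE; ring.
Qed.

Lemma hprojD p u v : hproj p (u + v) = hproj p u + hproj p v.
Proof. by have := hproj_lin p 1 u v; rewrite !scale1r. Qed.

Lemma hprojZ p (k : R) u : hproj p (k *: u) = k *: hproj p u.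
Proof.
have h0 : hproj p 0 = 0.
  by rewrite /hproj big1 ?subr0 // => a _; rewrite linear0 scale0r.
by have := hproj_lin p k u 0; rewrite h0 !addr0.
Qed.

Lemma hproj_id p v : (forall a, eta a p v = 0) -> hproj p v = v.
Proof.
by move=> v0; rewrite /hproj big1 ?subr0 // => a _; rewrite v0 scale0r.
Qed.

Lemma hpart_lin f F G : hpart S (fun q => f q *: F q + G q)
  = (fun q => f q *: hpart S F q + hpart S G q).
Proof. by apply/funext => q; exact: hproj_lin. Qed.

Lemma canonE p E F : canon E F p =
  hproj p (lc g (hpart S E) (hpart S F) p)
  + (\sum_a eta a p (E p) *: lie (xi a) (hpart S F) p
     + \sum_b der E (fun q => eta b q (F q)) p *: xi b p).
Proof. by rewrite canon.unlock. Qed.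

Lemma fsm_canon p E F : fsm p E -> fsm p F -> fsm p (canon E F).
Proof.
move=> sE sF; have sEh := fsm_hpart S sE; have sFh := fsm_hpart S sF.
rewrite canon.unlock; apply: fsmD.
  exact: (fsm_hpart S (fsm_lc g sEh sFh)).
apply: fsmD; apply: fsm_sum => a.
  exact: (fsmZ (sfun_eta S a sE) (fsm_lie (fsm_xi S p a) sFh)).
exact: (fsmZ (sfun_der sE (sfun_eta S a sF)) (fsm_xi S p a)).
Qed.

Lemma canon_linl p f E E' F : sfun p f -> fsm p E -> fsm p E' -> fsm p F ->
  canon (fun q => f q *: E q + E' q) F p = f p *: canon E F p + canon E' F p.
Proof.
move=> sf sE sE' sF; rewrite !canonE hpart_lin.
rewrite (lc_linl g sf (fsm_hpart S sE) (fsm_hpart S sE') (fsm_hpart S sF)).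
rewrite hproj_lin.
have -> : \sum_a eta a p (f p *: E p + E' p) *: lie (xi a) (hpart S F) p
   = f p *: (\sum_a eta a p (E p) *: lie (xi a) (hpart S F) p)
     + \sum_a eta a p (E' p) *: lie (xi a) (hpart S F) p.
  rewrite scaler_sumr -big_split; apply: eq_bigr => a _ /=.
  by rewrite linearP scalerDl scalerA.
have -> : \sum_b der (fun q => f q *: E q + E' q) (fun q => eta b q (F q)) p *: xi b p
   = f p *: (\sum_b der E (fun q => eta b q (F q)) p *: xi b p)
     + \sum_b der E' (fun q => eta b q (F q)) p *: xi b p.
  rewrite scaler_sumr -big_split; apply: eq_bigr => b _ /=.
  rewrite (@der_lin _ _ _ p (f p) (fun q => f q *: E q + E' q) E E' _
    (sfun_eta S b sF) erefl).
  by rewrite scalerDl scalerA.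
move: (hproj _ _) (hproj _ _) (\sum_(a < 3) _) (\sum_(a < 3) _) (\sum_(a < 3) _)
  (\sum_(a < 3) _) => x1 x2 x3 x4 x5 x6.
by apply/rowP => i; rewrite !mxE; ring.
Qed.

Lemma der_hpart p E f : sfun p f ->
  der E f p = der (hpart S E) f p + \sum_a eta a p (E p) * der (xi a) f p.
Proof.
move=> sf.
have H (r : seq 'I_3) : der (fun q => \sum_(a <- r) eta a p (E p) *: xi a q) f p
    = \sum_(a <- r) eta a p (E p) * der (xi a) f p.
  elim: r => [|a r IH].
    rewrite big_nil (@der_lin _ _ _ p (-1) _ (fun=> 0) (fun=> 0) f sf).
      by rewrite mulN1r addNr.
    by rewrite big_nil scaler0 addr0.
  by rewrite big_cons -IH; apply: der_lin => //; rewrite big_cons.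
rewrite -H (@der_lin _ _ _ p 1 E (hpart S E)
   (fun q => \sum_a eta a p (E p) *: xi a q) f sf) ?mul1r //.
by rewrite scale1r /hpart subrK.
Qed.

(** The Leibniz term (E f) F is assembled from all three parts of the connection. [lc] contributes
    (E^h f) F^h, the brackets contribute eta_a(E) (xi_a f) F^h, which [der_hpart] adds up to (E f)
    F^h, and the last sum contributes the vertical part of F. *)
Lemma canon_linr p f E F F' : sfun p f -> fsm p E -> fsm p F -> fsm p F' ->
  canon E (fun q => f q *: F q + F' q) p
  = f p *: canon E F p + der E f p *: F p + canon E F' p.
Proof.
move=> sf sE sF sF'; rewrite !canonE hpart_lin.
have sFh := fsm_hpart S sF; have sFh' := fsm_hpart S sF'.
rewrite (lc_linr g sf (fsm_hpart S sE) sFh sFh') hprojD hproj_lin hprojZ.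
rewrite [hproj p (hpart S F p)]hproj_id; last by move=> a; exact: eta_hpart.
have -> : \sum_a eta a p (E p) *: lie (xi a) (fun q => f q *: hpart S F q
      + hpart S F' q) p
   = f p *: (\sum_a eta a p (E p) *: lie (xi a) (hpart S F) p)
     + ((\sum_a eta a p (E p) * der (xi a) f p) *: hpart S F p
     + \sum_a eta a p (E p) *: lie (xi a) (hpart S F') p).
  rewrite scaler_sumr scaler_suml -!big_split; apply: eq_bigr => a _ /=.
  rewrite (lie_linr (fsm_xi S p a) sFh sFh' sf).
  by rewrite !scalerDr !scalerA [f p * _]mulrC.
have -> : \sum_b der E (fun q => eta b q (f q *: F q + F' q)) p *: xi b p
   = f p *: (\sum_b der E (fun q => eta b q (F q)) p *: xi b p)
     + (der E f p *: (\sum_b eta b p (F p) *: xi b p)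
     + \sum_b der E (fun q => eta b q (F' q)) p *: xi b p).
  rewrite !scaler_sumr -!big_split; apply: eq_bigr => b _ /=.
  have -> : (fun q => eta b q (f q *: F q + F' q))
     = (fun q => f q * eta b q (F q) + eta b q (F' q)).
    by apply/funext => q; rewrite linearP.
  have sb := sfun_eta S b sF; have sb' := sfun_eta S b sF'.
  rewrite (derD _ (sfunM sf sb) sb') (derM _ sf sb).
  by rewrite !scalerDl !scalerA addrA.
rewrite (der_hpart E sf) [in X in _ = _ + X + _](hpartE S F p).
move: (hproj _ _) (hproj _ _) (\sum_(a < 3) _) (\sum_(a < 3) _) (\sum_(a < 3) _)
  (\sum_(a < 3) _) (\sum_(a < 3) _) (\sum_(a < 3) _) (der _ _ _) (hpart _ _ _)
  => x1 x2 x3 x4 x5 x6 x7 x8 x9 x10.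
by apply/rowP => i; rewrite !mxE; ring.
Qed.

Lemma canon_linear_connection : linear_connection canon.
Proof.
have c0 p E : fsm p E -> canon E (fun=> 0) p = 0.
  move=> sE; have s0 := fsm0 p.
  have := canon_linr (sfun_cst p (-1)) sE s0 s0.
  have -> : (fun q : M => (-1 : R) *: (0 : 'rV[R]_((4 * n).+3)) + 0) = (fun=> 0).
    by apply/funext => q; rewrite scaler0 addr0.
  by rewrite scaler0 addr0 scaleN1r addNr.
split.
- move=> E F sE sF; apply/smooth_fieldP => p.
  exact: (fsm_canon (smooth_fsm p sE) (smooth_fsm p sF)).
- move=> f E E' F sf sE sE' sF p.
  exact: (canon_linl (smooth_sfun p sf) (smooth_fsm p sE) (smooth_fsm p sE')
    (smooth_fsm p sF)).
- move=> E F F' sE sF sF' p.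
  have := canon_linr (sfun_cst p 1) (smooth_fsm p sE) (smooth_fsm p sF)
    (smooth_fsm p sF').
  rewrite der_cst scale0r addr0 scale1r => <-; congr (canon E _ p).
  by apply/funext => q; rewrite scale1r.
- move=> f E F sf sE sF p; rewrite act_der.
  have := canon_linr (smooth_sfun p sf) (smooth_fsm p sE) (smooth_fsm p sF) (fsm0 p).
  rewrite (c0 _ _ (smooth_fsm p sE)) addr0 => <-; congr (canon E _ p).
  by apply/funext => q; rewrite addr0.
Qed.

Lemma hpart_smooth F : smooth_field F -> horizontal S (hpart S F).
Proof.
move=> sF; split=> [|a p]; last exact: eta_hpart.
by apply/smooth_fieldP => p; exact: (fsm_hpart S (smooth_fsm p sF)).
Qed.

Lemma horizontal_id X : horizontal S X -> hpart S X = X.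
Proof. by move=> [_ X0]; apply: hpart_id. Qed.

Lemma canon_horizontal p X Y : horizontal S X -> horizontal S Y ->
  canon X Y p = hpart S (lc g X Y) p.
Proof.
move=> hX hY; rewrite canonE (horizontal_id hX) (horizontal_id hY).
rewrite [X in _ + (X + _)]big1; last by move=> a _; rewrite hX.2 scale0r.
rewrite add0r big1 ?addr0 // => a _.
have -> : (fun q => eta a q (Y q)) = (fun=> 0) by apply/funext => q; exact: hY.2.
by rewrite der_cst scale0r.
Qed.

Lemma canon_preserves : preserves_horizontal S canon.
Proof.
move=> X Y hX hY.
have -> : canon X Y = hpart S (lc g X Y).
  by apply/funext => p; exact: canon_horizontal.
apply: hpart_smooth; apply/smooth_fieldP => p.
exact: (fsm_lc g (smooth_fsm p hX.1) (smooth_fsm p hY.1)).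
Qed.

Lemma hpart_xi a : hpart S (xi a) = fun=> 0.
Proof.
apply/funext => p; rewrite /hpart (bigD1 a) //= big1 ?addr0.
  by rewrite -/(eta a) eta_xi eqxx scale1r subrr.
by move=> b ba; rewrite -/(eta b) eta_xi (negbTE ba) scale0r.
Qed.

Lemma canon_parallel : parallel_xi S canon.
Proof.
move=> a E sE p; rewrite canonE hpart_xi.
rewrite (lc0r g (fsm_hpart S (smooth_fsm p sE))) hproj_id; last first.
  by move=> b; rewrite linear0.
rewrite add0r [X in X + _]big1; last first.
  by move=> b _; rewrite (lie0r (fsm_xi S p b)) scaler0.
rewrite add0r big1 // => b _.
have -> : (fun q => eta b q (xi a q)) = (fun=> (b == a)%:R).
  by apply/funext => q; exact: eta_xi.
by rewrite der_cst scale0r.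
Qed.

Lemma canon_metric : horizontally_metric S canon.
Proof.
move=> X Y Z hX hY hZ p; rewrite /cov_form2 act_der.
rewrite (canon_horizontal p hZ hX) (canon_horizontal p hZ hY).
rewrite (metric_hpart _ (fun a => hY.2 a p)) [g p (X p) _]metric_sym.
rewrite (metric_hpart _ (fun a => hX.2 a p)).
rewrite [der _ _ _](lc_metric g (smooth_fsm p hZ.1) (smooth_fsm p hX.1)
  (smooth_fsm p hY.1)).
by rewrite [g p (X p) _]metric_sym addrAC addrK subrr.
Qed.

Lemma canon_xi a p Y : horizontal S Y -> canon (xi a) Y p = lie (xi a) Y p.
Proof.
move=> hY; rewrite canonE (horizontal_id hY) hpart_xi.
have -> : lc g (fun=> 0) Y p = 0.
  have s0 := fsm0 p; have := lc_linl g (sfun_cst p (-1)) s0 s0 (smooth_fsm p hY.1).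
  have -> : (fun q : M => (-1 : R) *: (0 : 'rV[R]_((4 * n).+3)) + 0) = (fun=> 0).
    by apply/funext => q; rewrite scaler0 addr0.
  by rewrite scaleN1r addNr.
rewrite hproj_id; last by move=> b; rewrite linear0.
rewrite add0r [X in _ + X]big1 ?addr0; last first.
  move=> b _; have -> : (fun q => eta b q (Y q)) = (fun=> 0).
    by apply/funext => q; exact: hY.2.
  by rewrite der_cst scale0r.
rewrite (bigD1 a) //= big1 ?addr0; first by rewrite eta_xi eqxx scale1r.
by move=> b ba; rewrite eta_xi (negbTE ba) scale0r.
Qed.

Lemma d1E (eta' : form1 M) E F p : 2 * d1 eta' E F p
  = der E (fun q => eta' q (F q)) p - der F (fun q => eta' q (E q)) p
    - eta' p (lie E F p).
Proof.
by rewrite /d1 act_der bracket_lie mulrCA divff ?mulr1 // pnatr_eq0.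
Qed.

Lemma d1_horizontal p X Y a : horizontal S X -> horizontal S Y ->
  2 * d1 (eta a) X Y p = - eta a p (lie X Y p).
Proof.
move=> hX hY; rewrite d1E.
have H Z : horizontal S Z -> (fun q => eta a q (Z q)) = (fun=> 0).
  by move=> hZ; apply/funext => q; exact: hZ.2.
by rewrite (H _ hX) (H _ hY) !der_cst subrr sub0r.
Qed.

(** For horizontal X and Y the horizontal part of the torsion is that of nabla, which is zero. What
    remains is the vertical part of -[X, Y], whose coefficients are 2 d eta_a(X, Y). *)
Lemma canon_torsion : torsion_condition S canon.
Proof.
split=> [X Y hX hY p|a X hX p]; rewrite /torsion bracket_lie.
  rewrite (canon_horizontal p hX hY) (canon_horizontal p hY hX).
  have T := lc_torsion g (smooth_fsm p hX.1) (smooth_fsm p hY.1).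
  have -> : hpart S (lc g X Y) p = hpart S (lie X Y) p + hpart S (lc g Y X) p.
    by rewrite -[RHS](hprojD p) -T subrK.
  rewrite addrK /hpart addrAC subrr add0r scaler_sumr -sumrN.
  apply: eq_bigr => a _; rewrite scalerA (d1_horizontal p a hX hY) scaleNr.
  by [].
rewrite (canon_parallel a hX.1) (canon_xi a p hX) (lieC p X) sub0r opprK.
by rewrite addrC subrr.
Qed.

Lemma canon_canonical : canonical_connection S canon.
Proof.
exists (lc g); first exact: lc_levi_civita.
split.
- by move=> X Y hX hY p; exact: canon_horizontal.
- by move=> a Y hY p; rewrite bracket_lie; exact: canon_xi.
- exact: canon_parallel.
Qed.

(** Stated for a general D because it is applied to three connections: a competitor, [canon], and,
    on 3-cosymplectic manifolds, the Levi-Civita connection. *)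
Lemma connection_decomposition (D : field M -> field M -> field M) E F p :
  linear_connection D -> parallel_xi S D ->
  (forall a X, horizontal S X -> forall p, torsion D X (xi a) p = 0) ->
  smooth_field E -> smooth_field F ->
  D E F p = D (hpart S E) (hpart S F) p
    + (\sum_a eta a p (E p) *: lie (xi a) (hpart S F) p
       + \sum_b der E (fun q => eta b q (F q)) p *: xi b p).
Proof.
move=> cD px tx sE sF.
have [sEh _] := hpart_smooth sE; have [sFh _] := hpart_smooth sF.
have se a G : smooth_field G -> smooth_fun (fun q => eta a q (G q)).
  by move=> sG; apply/smooth_funP => q; exact: (sfun_eta S a (smooth_fsm q sG)).
have sx a : smooth_field (xi a) by exact: ac_xi_smooth.
have F1 : F = (fun q => \sum_a eta a q (F q) *: xi a q + hpart S F q).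
  by apply/funext => q; exact: hpartE.
have E1 : E = (fun q => \sum_a eta a q (E q) *: xi a q + hpart S E q).
  by apply/funext => q; exact: hpartE.
rewrite {1}F1.
rewrite (connection_sum_parallel (index_enum 'I_3) cD (fun a => se a _ sF) sx
  (fun a => px a E sE p) sE sFh).
rewrite {2}E1.
rewrite (connection_sum (index_enum 'I_3) p cD (fun a => se a _ sE) sx sEh sFh).
have H a : D (xi a) (hpart S F) p = lie (xi a) (hpart S F) p.
  have := tx a (hpart S F) (hpart_smooth sF) p.
  rewrite /torsion bracket_lie (px a _ sFh) (lieC p (hpart S F)) opprK sub0r.
  by rewrite addrC => /eqP; rewrite subr_eq0 => /eqP.
have -> : \sum_(a < 3) eta a p (E p) *: D (xi a) (hpart S F) p
    = \sum_a eta a p (E p) *: lie (xi a) (hpart S F) p.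
  by apply: eq_bigr => a _; rewrite H.
by rewrite addrA addrC [X in _ + X = _]addrC.
Qed.

(** By (iii) the torsion of horizontal fields is vertical, hence orthogonal to a horizontal test
    field, and the usual derivation of Koszul's formula for a torsion-free metric connection goes
    through. *)
Lemma horizontal_koszul (D : field M -> field M -> field M) X Y Z p :
  preserves_horizontal S D -> horizontally_metric S D -> torsion_condition S D ->
  horizontal S X -> horizontal S Y -> horizontal S Z ->
  2 * g p (D X Y p) (Z p) = kos g X Y Z p.
Proof.
move=> hD mD [tD _] hX hY hZ.
have T A B C : horizontal S A -> horizontal S B -> horizontal S C ->
    g p (lie A B p) (C p) = g p (D A B p) (C p) - g p (D B A p) (C p).
  move=> hA hB hC; have := tD _ _ hA hB p; rewrite /torsion bracket_lie.
  move/(congr1 (fun v => g p v (C p))).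
  rewrite !metricDl !metricNl metricZl metric_suml big1 => [|a _]; last first.
    by rewrite metricZl [X in _ * X]metric_xi hC.2 mulr0.
  by lra.
have N A B C : horizontal S A -> horizontal S B -> horizontal S C ->
    der C (mf g A B) p = g p (D C A p) (B p) + g p (A p) (D C B p).
  move=> hA hB hC; have := mD _ _ _ hA hB hC p; rewrite /cov_form2 act_der.
  by rewrite -/(mf g A B); lra.
rewrite /kos (N _ _ _ hY hZ hX) (N _ _ _ hX hZ hY) (N _ _ _ hX hY hZ).
rewrite (T _ _ _ hX hY hZ) (T _ _ _ hX hZ hY) (T _ _ _ hY hZ hX).
rewrite (metric_sym g p (Y p)) (metric_sym g p (X p)) (metric_sym g p (X p)).
ring.
Qed.

Lemma canon_unique (D : field M -> field M -> field M) :
  linear_connection D -> preserves_horizontal S D -> parallel_xi S D ->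
  horizontally_metric S D -> torsion_condition S D ->
  forall E F, smooth_field E -> smooth_field F -> forall p,
  D E F p = canon E F p.
Proof.
move=> cD hD pD mD tD E F sE sF p.
rewrite (connection_decomposition p cD pD tD.2 sE sF).
rewrite (connection_decomposition p canon_linear_connection canon_parallel
  canon_torsion.2 sE sF); congr (_ + _).
have hE := hpart_smooth sE; have hF := hpart_smooth sF.
have [s1 h1] := hD _ _ hE hF; have [s2 h2] := canon_preserves hE hF.
(* Both connections preserve horizontality, so W is an admissible third argument of the formula
   above. *)
pose W : field M := fun q => D (hpart S E) (hpart S F) q
  - canon (hpart S E) (hpart S F) q.
have hW : horizontal S W.
  split=> [|a q]; last by rewrite /W linearB /= h1 h2 subr0.
  by apply/smooth_fieldP => q; exact: (fsmB (smooth_fsm q s1) (smooth_fsm q s2)).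
apply/eqP; rewrite -subr_eq0; apply/negP => /negP W0.
have := metric_pos g p W0; rewrite -/(W p).
have := horizontal_koszul p hD mD tD hE hF hW.
rewrite -(horizontal_koszul p canon_preserves canon_metric canon_torsion hE hF hW).
rewrite /W !metricDl !metricNl !metricDr !metricNr.
by lra.
Qed.

End Canonical.

(** * Normal structures with closed fundamental form *)

Section NormalClosed.
Variables (R : realType) (n : nat) (M : smoothManifold R (4 * n).+3).
Variable S : almost_3contact_metric M.
Implicit Types (p q : M) (a b c : 'I_3) (u v w : 'rV[R]_((4 * n).+3))
  (f : M -> R) (X Y Z E F G : field M).

Local Notation phi := (phi3 S).
Local Notation xi := (xi3 S).
Local Notation eta := (eta3 S).
Local Notation g := (met3 S).
Local Notation canon := (canon S).

Definition phif a X : field M := fun q => phi a q (X q).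

Lemma phif_sq a X : (forall q, eta a q (X q) = 0) ->
  phif a (phif a X) = (fun q => - X q).
Proof.
by move=> X0; apply/funext => q; rewrite /phif phi_sq X0 scale0r addr0.
Qed.

Lemma fsm_phif p a X : fsm p X -> fsm p (phif a X).
Proof. exact: fsm_phi. Qed.

Lemma smooth_phif a X : smooth_field X -> smooth_field (phif a X).
Proof.
by move=> sX; apply/smooth_fieldP => q; exact: (fsm_phif a (smooth_fsm q sX)).
Qed.

Lemma smooth_xi a : smooth_field (xi a).
Proof. exact: ac_xi_smooth. Qed.

Lemma lie0l p E : fsm p E -> lie (fun=> 0) E p = 0.
Proof. by move=> sE; rewrite lieC (lie0r sE) oppr0. Qed.

Lemma d2_Phi a X Y Z p : 3 * d2 (Phi3 S a) X Y Z p =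
  der X (mf g Y (phif a Z)) p + der Y (mf g Z (phif a X)) p
  + der Z (mf g X (phif a Y)) p
  - g p (lie X Y p) (phif a Z p) - g p (lie Y Z p) (phif a X p)
  - g p (lie Z X p) (phif a Y p).
Proof.
by rewrite /d2 act_der bracket_lie mulrCA divff ?mulr1 // pnatr_eq0.
Qed.

(** This is (nabla_X Phi_a)(Y, Z) = g(Y, (nabla_X phi_a) Z). *)
Definition nabla_Phi a X Y Z p : R :=
  g p (Y p) (lc g X (phif a Z) p) - g p (Y p) (phi a p (lc g X Z p)).

Section Identities.
Variables (a : 'I_3) (p : M).

Lemma nabla_Phi_skew X Y Z : fsm p X -> fsm p Y -> fsm p Z ->
  nabla_Phi a X Y Z p = - nabla_Phi a X Z Y p.
Proof.
move=> sX sY sZ; have sfY := fsm_phif a sY; have sfZ := fsm_phif a sZ.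
have H1 := lc_metric g sX sY sfZ; have H2 := lc_metric g sX sfY sZ.
have : mf g (phif a Y) Z = (fun q => - mf g Y (phif a Z) q).
  by apply/funext => q; rewrite /mf metric_phi.
move=> E; rewrite E (derN _ (sfun_mf g sY sfZ)) H1 in H2.
have e1 : g p (phif a Y p) (lc g X Z p) = - g p (Y p) (phi a p (lc g X Z p)).
  exact: metric_phi.
have e2 : g p (Z p) (phi a p (lc g X Y p)) = - g p (lc g X Y p) (phif a Z p).
  by rewrite metric_sym metric_phi.
have e3 := metric_sym g p (lc g X (phif a Y) p) (Z p).
by move: H2; rewrite e1 e3 /nabla_Phi e2; lra.
Qed.

(** Differentiating phi_a^2 = -1 on ker eta_a shows that nabla phi_a anticommutes with phi_a up to a
    multiple of xi_a, which is orthogonal to Y; skewness of phi_a then moves it to the other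
    slot. *)
Lemma nabla_Phi_phi X Y Z : fsm p X -> fsm p Y -> fsm p Z ->
  eta a p (Y p) = 0 -> (forall q, eta a q (Z q) = 0) ->
  nabla_Phi a X Y (phif a Z) p = nabla_Phi a X (phif a Y) Z p.
Proof.
move=> sX sY sZ Y0 Z0; rewrite /nabla_Phi (phif_sq Z0) (lcN g sX sZ) metricNr.
rewrite /phif !metric_phi phi_sq metricDr metricZr metricNr.
by rewrite [g p _ (xi a p)]metric_sym metric_xi Y0; lra.
Qed.

Lemma nabla_PhiNr X Y Z : fsm p X -> fsm p Z ->
  nabla_Phi a X Y (fun q => - Z q) p = - nabla_Phi a X Y Z p.
Proof.
move=> sX sZ; rewrite /nabla_Phi (lcN g sX sZ).
have -> : phif a (fun q => - Z q) = (fun q => - phif a Z q).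
  by apply/funext => q; rewrite /phif linearN.
by rewrite (lcN g sX (fsm_phif a sZ)) linearN !metricNr; lra.
Qed.

(** Since nabla is torsion-free, 3 d Phi_a is the cyclic sum of nabla Phi_a. *)
Lemma nabla_Phi_cyclic X Y Z : fsm p X -> fsm p Y -> fsm p Z ->
  d2 (Phi3 S a) X Y Z p = 0 ->
  nabla_Phi a X Y Z p + nabla_Phi a Y Z X p + nabla_Phi a Z X Y p = 0.
Proof.
move=> sX sY sZ d0; have := d2_Phi a X Y Z p; rewrite d0 mulr0.
rewrite (lc_metric g sX sY (fsm_phif a sZ)) (lc_metric g sY sZ (fsm_phif a sX)).
rewrite (lc_metric g sZ sX (fsm_phif a sY)).
rewrite -(lc_torsion g sX sY) -(lc_torsion g sY sZ) -(lc_torsion g sZ sX).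
rewrite !metricDl !metricNl /nabla_Phi.
have H u v : g p u (phi a p v) = - g p v (phi a p u).
  by rewrite metric_sym metric_phi.
rewrite (H (Y p) (lc g X Z p)) (H (Z p) (lc g Y X p)) (H (X p) (lc g Z Y p)).
rewrite /phif; lra.
Qed.

(** The brackets in the Nijenhuis tensor are expressed through the torsion-free nabla; pairing with
    Z in ker eta_a removes every multiple of xi_a, in particular the d eta_a term. *)
Lemma nabla_Phi_normal X Y Z : fsm p X -> fsm p Y -> fsm p Z ->
  nijenhuis (phi a) X Y p + (2 * d1 (eta a) X Y p) *: xi a p = 0 ->
  eta a p (Z p) = 0 ->
  nabla_Phi a (phif a X) Z Y p - nabla_Phi a (phif a Y) Z X p
  - nabla_Phi a Y (phif a Z) X p + nabla_Phi a X (phif a Z) Y p = 0.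
Proof.
move=> sX sY sZ N0 Z0; have := congr1 (g p (Z p)) N0.
rewrite /nijenhuis bracket_lie -/(phif a X) -/(phif a Y).
rewrite phi_sq !metricDr !metricNr !metricZr metric0r.
rewrite [g p _ (xi a p)]metric_sym metric_xi Z0.
have sfX := fsm_phif a sX; have sfY := fsm_phif a sY.
rewrite -(lc_torsion g sX sY) -(lc_torsion g sfX sfY).
rewrite -(lc_torsion g sfX sY) -(lc_torsion g sX sfY).
rewrite !linearB /= !metricDr !metricNr /nabla_Phi /phif !metric_phi !phi_sq.
rewrite !metricDr !metricNr !metricZr.
by rewrite [g p _ (xi a p)]metric_sym metric_xi Z0; lra.
Qed.

End Identities.

Hypothesis Phi_closed : forall a X Y Z p, smooth_field X -> smooth_field Y ->
  smooth_field Z -> d2 (Phi3 S a) X Y Z p = 0.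
Hypothesis S_normal : forall a, normal (str3 S a).
Hypothesis d1_xi : forall a F p, smooth_field F -> d1 (eta a) (xi a) F p = 0.

(* The argument that makes closed normal almost Hermitian structures Kaehler,
   on the kernel of eta_a. *)
Lemma nabla_Phi_eq0 a p X Y Z : smooth_field X -> smooth_field Y ->
  smooth_field Z ->
  (forall q, eta a q (X q) = 0) -> (forall q, eta a q (Y q) = 0) ->
  (forall q, eta a q (Z q) = 0) -> nabla_Phi a X Y Z p = 0.
Proof.
move=> sX sY sZ X0 Y0 Z0.
have sfX := smooth_phif a sX; have sfY := smooth_phif a sY.
have sfZ := smooth_phif a sZ.
have f0 V q : eta a q (phif a V q) = 0 by exact: eta_phi_diag.
have gX := smooth_fsm p sX; have gY := smooth_fsm p sY; have gZ := smooth_fsm p sZ.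
have gfX := smooth_fsm p sfX; have gfY := smooth_fsm p sfY.
have gfZ := smooth_fsm p sfZ.
(* Write n for [nabla_Phi a]. After e1, e2 and e3, the identity c2 says that the first two terms of
   N add up to -n(X, Y, Z). By e4, e5 and e6 the last two are n(Z, X, Y) + n(Y, Z, X), which c1 also
   equates with -n(X, Y, Z). Hence 2 n(X, Y, Z) = 0. *)
have c1 := nabla_Phi_cyclic gX gY gZ (Phi_closed a p sX sY sZ).
have c2 := nabla_Phi_cyclic gX gfY gfZ (Phi_closed a p sX sfY sfZ).
have N := nabla_Phi_normal gY gZ gfX (S_normal a sY sZ p) (f0 X p).
have e1 : nabla_Phi a X (phif a Y) (phif a Z) p = - nabla_Phi a X Y Z p.
  rewrite -(nabla_Phi_phi gX gY gfZ (Y0 p) (f0 Z)) (phif_sq Z0).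
  by rewrite nabla_PhiNr.
have e2 : nabla_Phi a (phif a Y) (phif a Z) X p
    = - nabla_Phi a (phif a Y) (phif a X) Z p.
  rewrite -(nabla_Phi_phi gfY gZ gX (Z0 p) X0).
  exact: nabla_Phi_skew.
have e3 : nabla_Phi a (phif a Z) X (phif a Y) p
    = nabla_Phi a (phif a Z) (phif a X) Y p.
  exact: (nabla_Phi_phi gfZ gX gY (X0 p) Y0).
have e4 : nabla_Phi a Z (phif a (phif a X)) Y p = - nabla_Phi a Z X Y p.
  by rewrite /nabla_Phi (phif_sq X0) !metricNl; lra.
have e5 : nabla_Phi a Y (phif a (phif a X)) Z p = - nabla_Phi a Y X Z p.
  by rewrite /nabla_Phi (phif_sq X0) !metricNl; lra.
have e6 := nabla_Phi_skew a gY gX gZ.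
lra.
Qed.

Lemma eta_lie_xi a p F : smooth_field F ->
  eta a p (lie (xi a) (phif a F) p) = 0.
Proof.
move=> sF; have := d1E (eta a) (xi a) (phif a F) p.
rewrite (d1_xi a p (smooth_phif a sF)) mulr0.
have -> : (fun q => eta a q (phif a F q)) = (fun=> 0).
  by apply/funext => q; exact: eta_phi_diag.
have -> : (fun q => eta a q (xi a q)) = (fun=> 1).
  by apply/funext => q; rewrite eta_xi eqxx.
by rewrite !der_cst subrr sub0r => /eqP; rewrite eq_sym oppr_eq0 => /eqP.
Qed.

(** Normality on (xi_a, F) yields the identity only after applying phi_a, because phi_a xi_a = 0.
    The undetermined xi_a component is zero by [eta_lie_xi]. *)
Lemma lie_xi_phi a p F : smooth_field F ->
  lie (xi a) (phif a F) p = phi a p (lie (xi a) F p).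
Proof.
move=> sF; have := S_normal a (smooth_xi a) sF p.
rewrite -/(eta a) -/(xi a) (d1_xi a p sF) mulr0 scale0r addr0.
rewrite /nijenhuis bracket_lie -/(phi a) -/(phif a F).
have -> : (fun q => phi a q (xi a q)) = (fun=> 0).
  by apply/funext => q; exact: phi_xi_diag.
rewrite (lie0l (smooth_fsm p (smooth_phif a sF))) (lie0l (smooth_fsm p sF)).
rewrite linear0 addr0 subr0 -linearB.
move/(congr1 (phi a p)); rewrite linear0 phi_sq linearB /=.
rewrite [eta a p _]linearB /= eta_phi_diag (eta_lie_xi a p sF) subrr scale0r addr0.
by rewrite opprK addrC => /eqP; rewrite subr_eq0 => /eqP.
Qed.

(* This is d Phi_a (xi_b, Z, Y) = 0, the contraction of Phi_a with xi_b being a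
   combination of the eta_c. *)
Lemma lie_Phi a b p Z Y : smooth_field Z -> smooth_field Y ->
  der (xi b) (mf g Z (phif a Y)) p - g p (lie (xi b) Z p) (phif a Y p)
    - g p (Z p) (phi a p (lie (xi b) Y p))
  = - \sum_c eps R a b c * (2 * d1 (eta c) Z Y p).
Proof.
move=> sZ sY; have := d2_Phi a (xi b) Z Y p.
rewrite (Phi_closed a p (smooth_xi b) sZ sY) mulr0.
have sc c V : smooth_field V -> sfun p (fun q => eta c q (V q)).
  by move=> sV; exact: (sfun_eta S c (smooth_fsm p sV)).
have K V q : g q (V q) (phif a (xi b) q) = \sum_c eps R a b c * eta c q (V q).
  rewrite /phif phi_xi metric_sumr; apply: eq_bigr => c _.
  by rewrite metricZr metric_sym metric_xi.
have D V W : smooth_field V -> der W (mf g V (phif a (xi b))) p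
    = \sum_c eps R a b c * der W (fun q => eta c q (V q)) p.
  move=> sV; have -> : mf g V (phif a (xi b))
      = (fun q => \sum_c eps R a b c * eta c q (V q)).
    by apply/funext => q; exact: K.
  rewrite der_sum; last first.
    by move=> c; exact: (sfunM (sfun_cst p _) (sc c V sV)).
  by apply: eq_bigr => c _; exact: (derZ _ _ (sc c V sV)).
have -> : mf g (xi b) (phif a Z) = (fun q => - mf g Z (phif a (xi b)) q).
  by apply/funext => q; rewrite /mf /phif metric_sym metric_phi.
rewrite (derN _ (sfun_mf g (smooth_fsm p sZ) (fsm_phif a (fsm_xi S p b)))).
rewrite (D Y Z sY) (D Z Y sZ) (K (lie Z Y)).
have -> : g p (lie Y (xi b) p) (phif a Z p) = g p (Z p) (phi a p (lie (xi b) Y p)).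
  by rewrite (lieC p Y) metricNl /phif metric_sym metric_phi opprK.
have -> : \sum_c eps R a b c * (2 * d1 (eta c) Z Y p)
   = \sum_c eps R a b c * der Z (fun q => eta c q (Y q)) p
     - \sum_c eps R a b c * der Y (fun q => eta c q (Z q)) p
     - \sum_c eps R a b c * eta c p (lie Z Y p).
  rewrite -!sumrB; apply: eq_bigr => c _; rewrite d1E; ring.
by lra.
Qed.

(** For b = a the right-hand side of [lie_Phi] is zero, so xi_a preserves Phi_a; as it also
    preserves phi_a, it preserves g on pairs (Z, phi_a Y). *)
Lemma xi_killing_phi a p Z Y : smooth_field Z -> smooth_field Y ->
  der (xi a) (mf g Z (phif a Y)) p
  = g p (lie (xi a) Z p) (phif a Y p) + g p (Z p) (lie (xi a) (phif a Y) p).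
Proof.
move=> sZ sY; have := lie_Phi a a p sZ sY; rewrite (lie_xi_phi a p sY) big1.
  by lra.
by move=> c _; rewrite eps_diag mul0r.
Qed.

(** On ker eta_a each Y is phi_a(- phi_a Y), which reduces this to the previous case. *)
Lemma xi_killing_ker a p Z Y : smooth_field Z -> smooth_field Y ->
  (forall q, eta a q (Y q) = 0) ->
  der (xi a) (mf g Z Y) p
  = g p (lie (xi a) Z p) (Y p) + g p (Z p) (lie (xi a) Y p).
Proof.
move=> sZ sY Y0.
have sNY : smooth_field (fun q => - phif a Y q).
  apply/smooth_fieldP => q; exact: (fsmN (fsm_phif a (smooth_fsm q sY))).
have YE : Y = phif a (fun q => - phif a Y q).
  apply/funext => q; transitivity (- phif a (phif a Y) q).
    by rewrite (phif_sq Y0) opprK.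
  by rewrite /phif linearN.
rewrite {1 2 3}YE; exact: xi_killing_phi.
Qed.

(** Horizontality of Y puts phi_a Y in ker eta_b, where xi_b preserves g; of the Lie derivative of
    Phi_a only the derivative of phi_a is left. *)
Lemma lie_phi a b p Z Y : smooth_field Z -> horizontal S Y ->
  g p (Z p) (lie (xi b) (phif a Y) p - phi a p (lie (xi b) Y p))
  = - \sum_c eps R a b c * (2 * d1 (eta c) Z Y p).
Proof.
move=> sZ [sY Y0]; rewrite -(lie_Phi a b p sZ sY).
rewrite (xi_killing_ker p sZ (smooth_phif a sY)).
  by rewrite metricDr metricNr; lra.
by move=> q; apply: eta_phi_horizontal => c; exact: Y0.
Qed.

(** The nabla part of the connection commutes with phi_a by [nabla_Phi_eq0], and the vertical part
    does because phi_a acts on the xi_b with constant coefficients. Only the brackets are left. *)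
Lemma cov_canon_phi a E F p : smooth_field E -> smooth_field F ->
  cov_tensor11 canon (phi a) E F p
  = \sum_b eta b p (E p) *: (lie (xi b) (phif a (hpart S F)) p
                             - phi a p (lie (xi b) (hpart S F) p)).
Proof.
move=> sE sF; rewrite /cov_tensor11 -/(phif a F) !canonE.
have hE := hpart_smooth S sE; have hF := hpart_smooth S sF.
have <- : phif a (hpart S F) = hpart S (phif a F) by exact: phi_hpart.
set X := hpart S E in hE *; set Y := hpart S F in hF *.
have fY0 c q : eta c q (phif a Y q) = 0.
  by apply: eta_phi_horizontal => d; exact: hF.2.
have hfY : horizontal S (phif a Y) by split; [exact: smooth_phif hF.1|exact: fY0].
have W0 : hproj S p (lc g X (phif a Y) p) = phi a p (hproj S p (lc g X Y p)).
  (* The defect as a field, smooth and horizontal everywhere, so that [nabla_Phi_eq0] can be tested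
     against it. *)
  pose W : field M := fun q => hpart S (lc g X (phif a Y)) q
    - phif a (hpart S (lc g X Y)) q.
  have s1 : smooth_field (lc g X (phif a Y)).
    by apply/smooth_fieldP => q; exact: (fsm_lc g (smooth_fsm q hE.1)
      (smooth_fsm q hfY.1)).
  have s2 : smooth_field (lc g X Y).
    by apply/smooth_fieldP => q; exact: (fsm_lc g (smooth_fsm q hE.1)
      (smooth_fsm q hF.1)).
  have sW : smooth_field W.
    apply/smooth_fieldP => q; apply: fsmB.
      exact: (fsm_hpart S (smooth_fsm q s1)).
    exact: (fsm_phif a (fsm_hpart S (smooth_fsm q s2))).
  have W0 c q : eta c q (W q) = 0.
    rewrite /W linearB /= -/(eta c) eta_hpart /phif eta_phi_horizontal ?subr0 //.
    by move=> d; exact: eta_hpart.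
  apply/eqP; rewrite -subr_eq0; apply/negP => /negP nW.
  have := metric_pos g p nW; rewrite -/(W p) {1}/W /phif.
  have -> : phi a p (hpart S (lc g X Y) p) = hpart S (phif a (lc g X Y)) p.
    by rewrite -phi_hpart.
  rewrite metricDl metricNl !metric_hpart; last 2 first.
  - by move=> c; exact: W0.
  - by move=> c; exact: W0.
  have := nabla_Phi_eq0 p hE.1 sW hF.1 (hE.2 a) (W0 a) (hF.2 a).
  rewrite /nabla_Phi !(metric_sym g p (W p)) /phif => ->.
  by rewrite ltxx.
rewrite W0; move: (hproj S p (lc g X Y p)) => A.
rewrite !(linearD (phi a p)) /= !(linear_sum (phi a p)) /=.
have -> : \sum_b der E (fun q => eta b q (phif a F q)) p *: xi b p
    = \sum_b phi a p (der E (fun q => eta b q (F q)) p *: xi b p).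
  transitivity (\sum_b \sum_c (eps R b a c * der E (fun q => eta c q (F q)) p)
                  *: xi b p).
    apply: eq_bigr => b _; rewrite -scaler_suml; congr (_ *: _).
    have sc c : sfun p (fun q => eta c q (F q)).
      exact: (sfun_eta S c (smooth_fsm p sF)).
    have -> : (fun q => eta b q (phif a F q))
        = (fun q => \sum_c eps R b a c * eta c q (F q)).
      by apply/funext => q; exact: eta_phi.
    rewrite der_sum; last by move=> c; exact: (sfunM (sfun_cst p _) (sc c)).
    by apply: eq_bigr => c _; exact: (derZ _ _ (sc c)).
  rewrite exchange_big; apply: eq_bigr => c _ /=.
  rewrite linearZ /= phi_xi scaler_sumr; apply: eq_bigr => b _.
  by rewrite scalerA mulrC eps_cycle.
under [X in _ = X]eq_bigr do rewrite scalerBr.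
rewrite sumrB.
have -> : \sum_(b < 3) phi a p (eta b p (E p) *: lie (xi b) Y p)
   = \sum_b eta b p (E p) *: phi a p (lie (xi b) Y p).
  by apply: eq_bigr => b _; rewrite linearZ.
move: (phi a p A) (\sum_(b < 3) _) (\sum_(b < 3) _) (\sum_(b < 3) _)
  => x1 x2 x3 x4.
by apply/rowP => i; rewrite !mxE; ring.
Qed.

End NormalClosed.

(** * 3-Sasakian and 3-cosymplectic manifolds *)

Section SpecialGeometries.
Variables (R : realType) (n : nat) (M : smoothManifold R (4 * n).+3).
Variable S : almost_3contact_metric M.
Implicit Types (p q : M) (a b c : 'I_3) (u v w : 'rV[R]_((4 * n).+3))
  (f : M -> R) (X Y Z E F G : field M).

Local Notation phi := (phi3 S).
Local Notation xi := (xi3 S).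
Local Notation eta := (eta3 S).
Local Notation g := (met3 S).
Local Notation canon := (canon S).
Local Notation phif := (phif S).

Lemma smooth_field_lie X Y : smooth_field X -> smooth_field Y ->
  smooth_field (lie X Y).
Proof.
move=> sX sY; apply/smooth_fieldP => q.
exact: (fsm_lie (smooth_fsm q sX) (smooth_fsm q sY)).
Qed.

(** * The 3-Sasakian case *)

Section Sasakian.
Hypothesis S_sas : sasakian3 S.

Lemma sasakian_d1 a X Y : smooth_field X -> smooth_field Y ->
  d1 (eta a) X Y = mf g X (phif a Y).
Proof.
by move=> sX sY; apply/funext => q; rewrite (S_sas a).1.
Qed.

(** Phi_a = d eta_a, so this is d d eta_a = 0: second derivatives cancel because brackets act as
    commutators, and the iterated brackets cancel by Jacobi. *)
Lemma sasakian_closed a X Y Z p : smooth_field X -> smooth_field Y ->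
  smooth_field Z -> d2 (Phi3 S a) X Y Z p = 0.
Proof.
move=> sX sY sZ; have := d2_Phi S a X Y Z p.
have sXY := smooth_field_lie sX sY; have sYZ := smooth_field_lie sY sZ.
have sZX := smooth_field_lie sZ sX.
have L U V W : smooth_field U -> smooth_field V -> smooth_field W ->
    2 * g p (lie U V p) (phif a W p)
    = der (lie U V) (fun q => eta a q (W q)) p
      - der W (fun q => eta a q (lie U V q)) p - eta a p (lie (lie U V) W p).
  move=> sU sV sW; have sUV := smooth_field_lie sU sV.
  by rewrite -d1E (sasakian_d1 a sUV sW).
have sfe V : smooth_field V -> sfun p (fun q => eta a q (V q)).
  by move=> sV; exact: (sfun_eta S a (smooth_fsm p sV)).
have D U V W : smooth_field U -> smooth_field V -> smooth_field W ->
    2 * der U (mf g V (phif a W)) p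
    = der U (der V (fun q => eta a q (W q))) p
      - der U (der W (fun q => eta a q (V q))) p
      - der U (fun q => eta a q (lie V W q)) p.
  move=> sU sV sW.
  have sVe := sfun_der (smooth_fsm p sV) (sfe _ sW).
  have sWe := sfun_der (smooth_fsm p sW) (sfe _ sV).
  rewrite -(derB _ sVe sWe) -(derB _ (sfunB sVe sWe) (sfe _ (smooth_field_lie sV sW))).
  rewrite -derZ; last exact: (sfun_mf g (smooth_fsm p sV)
    (fsm_phif S a (smooth_fsm p sW))).
  congr (der U _ p); apply/funext => q.
  by rewrite -(sasakian_d1 a sV sW) d1E.
have J : eta a p (lie (lie X Y) Z p) + eta a p (lie (lie Y Z) X p)
    + eta a p (lie (lie Z X) Y p) = 0.
  rewrite -!linearD (lie_jacobi (smooth_fsm p sX) (smooth_fsm p sY) (smooth_fsm p sZ)).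
  exact: linear0.
have := (D _ _ _ sX sY sZ, D _ _ _ sY sZ sX, D _ _ _ sZ sX sY).
have := (L _ _ _ sX sY sZ, L _ _ _ sY sZ sX, L _ _ _ sZ sX sY).
rewrite (der_lie (smooth_fsm p sX) (smooth_fsm p sY) (sfe _ sZ)).
rewrite (der_lie (smooth_fsm p sY) (smooth_fsm p sZ) (sfe _ sX)).
rewrite (der_lie (smooth_fsm p sZ) (smooth_fsm p sX) (sfe _ sY)).
move=> [[L1 L2] L3] [[D1 D2] D3]; lra.
Qed.

Lemma sasakian_d1_xi a F p : smooth_field F -> d1 (eta a) (xi a) F p = 0.
Proof.
move=> sF; rewrite (sasakian_d1 a (smooth_xi S a) sF) /mf metric_xi.
exact: eta_phi_diag.
Qed.

(** With d eta_c(Z, Y) = g(Z, phi_c Y), the formula of [lie_phi] becomes a product with Z on both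
    sides; Z is taken to be the difference of the two vectors. *)
Lemma sasakian_lie_phi a b p Y : horizontal S Y ->
  lie (xi b) (phif a Y) p - phi a p (lie (xi b) Y p)
  = - (2 *: \sum_c eps R a b c *: phi c p (Y p)).
Proof.
move=> hY; have sY := hY.1; have sfY c := smooth_phif S c sY.
pose Z : field M := fun q => lie (xi b) (phif a Y) q - phi a q (lie (xi b) Y q)
  + 2 *: \sum_c eps R a b c *: phif c Y q.
have sZ : smooth_field Z.
  apply/smooth_fieldP => q; have sxb := fsm_xi S q b.
  apply: fsmD.
    apply: fsmB; first exact: (fsm_lie sxb (smooth_fsm q (sfY a))).
    exact: (fsm_phif S a (fsm_lie sxb (smooth_fsm q sY))).
  apply: fsmZ; first exact: sfun_cst.
  apply: fsm_sum => c; apply: fsmZ; first exact: sfun_cst.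
  exact: (smooth_fsm q (sfY c)).
apply/eqP; rewrite -subr_eq0 opprK; apply/negP => /negP nZ.
have := metric_pos g p nZ; rewrite -[X in g p X _]/(Z p) metricDr.
rewrite (lie_phi sasakian_closed (fun a => (S_sas a).2) sasakian_d1_xi a b p sZ hY).
rewrite metricZr metric_sumr.
have -> : \sum_c eps R a b c * (2 * d1 (eta c) Z Y p)
    = 2 * \sum_(c < 3) g p (Z p) (eps R a b c *: phi c p (Y p)).
  rewrite mulr_sumr; apply: eq_bigr => c _.
  by rewrite (sasakian_d1 c sZ sY) metricZr /mf /phif mulrCA.
by rewrite addNr ltxx.
Qed.

Lemma sasakian_cov_phi a E F p : smooth_field E -> smooth_field F ->
  cov_tensor11 canon (phi a) E F p =
  - \sum_b \sum_c eps R a b c *: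
      (eta b p (E p) *: phi c p (hpart S F p)
       - eta c p (E p) *: phi b p (hpart S F p)).
Proof.
move=> sE sF.
rewrite (cov_canon_phi sasakian_closed (fun a => (S_sas a).2) a p sE sF).
under eq_bigr do rewrite (sasakian_lie_phi _ _ _ (hpart_smooth S sF)).
(* By antisymmetry of eps the two halves of the asserted sum are both T, which accounts for the
   factor 2 in [sasakian_lie_phi]. *)
pose T := \sum_b \sum_c eps R a b c *: (eta b p (E p) *: phi c p (hpart S F p)).
have T' : \sum_b \sum_c eps R a b c *: (eta c p (E p) *: phi b p (hpart S F p)) = - T.
  rewrite exchange_big /T -sumrN; apply: eq_bigr => b _.
  by rewrite -sumrN; apply: eq_bigr => c _; rewrite eps_swap scaleNr.
have -> : \sum_b \sum_c eps R a b c *: (eta b p (E p) *: phi c p (hpart S F p)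
       - eta c p (E p) *: phi b p (hpart S F p)) = T - - T.
  rewrite -T' /T -sumrB; apply: eq_bigr => b _; rewrite -sumrB.
  by apply: eq_bigr => c _; rewrite scalerBr.
rewrite opprK -[T + T]/(T *+ 2) -scaler_nat /T scaler_sumr -sumrN.
apply: eq_bigr => b _; rewrite scalerN; congr (- _).
rewrite !scaler_sumr; apply: eq_bigr => c _.
by rewrite !scalerA mulrCA [eta _ _ _ * _]mulrC mulrA.
Qed.

End Sasakian.

(** * The 3-cosymplectic case *)

Section Cosymplectic.
Hypothesis S_cos : cosymplectic3 S.

Let d1_eta a E F p : smooth_field E -> smooth_field F -> d1 (eta a) E F p = 0.
Proof. by move=> sE sF; have [H _ _] := S_cos a; exact: H. Qed.

Let Phi_closed a X Y Z p : smooth_field X -> smooth_field Y ->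
  smooth_field Z -> d2 (Phi3 S a) X Y Z p = 0.
Proof. by move=> sX sY sZ; have [_ H _] := S_cos a; exact: H. Qed.

Let S_normal a : normal (str3 S a).
Proof. by have [] := S_cos a. Qed.

Let d1_xi a F p : smooth_field F -> d1 (eta a) (xi a) F p = 0.
Proof. by move=> sF; exact: (d1_eta a p (smooth_xi S a) sF). Qed.

Lemma mf_xi a F : mf g (xi a) F = (fun q => eta a q (F q)).
Proof. by apply/funext => q; exact: metric_xi. Qed.

(** Only the component of Y along xi_a is new; for it the claim amounts to xi_a(eta_a(Z)) =
    eta_a([xi_a, Z]), that is d eta_a(xi_a, Z) = 0. *)
Lemma cosymplectic_killing a p Z Y : smooth_field Z -> smooth_field Y ->
  der (xi a) (mf g Z Y) p
  = g p (lie (xi a) Z p) (Y p) + g p (Z p) (lie (xi a) Y p).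
Proof.
move=> sZ sY; have sx := smooth_xi S a; have gx := smooth_fsm p sx.
have gZ := smooth_fsm p sZ; have gY := smooth_fsm p sY.
pose Y' : field M := fun q => - eta a q (Y q) *: xi a q + Y q.
have se q : sfun q (fun q => eta a q (Y q)) := sfun_eta S a (smooth_fsm q sY).
have sY' : smooth_field Y'.
  apply/smooth_fieldP => q.
  exact: (fsm_lin (sfunN (se q)) (smooth_fsm q sx) (smooth_fsm q sY)).
have Y0 q : eta a q (Y' q) = 0.
  by rewrite /Y' linearP /= eta_xi eqxx mulr1 addNr.
have YE : Y = (fun q => eta a q (Y q) *: xi a q + Y' q).
  by apply/funext => q; rewrite /Y' scaleNr addrA subrr add0r.
have K := xi_killing_ker Phi_closed S_normal d1_xi p sZ sY' Y0.
have xx : lie (xi a) (xi a) p = 0.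
  have := lieC p (xi a) (xi a) => /eqP; rewrite -addr_eq0 => /eqP e.
  apply/rowP => i; have := congr1 (fun v : 'rV[R]_((4 * n).+3) => v 0 i) e.
  by rewrite !mxE; lra.
have D := d1E (eta a) (xi a) Z p.
rewrite (d1_xi a p sZ) mulr0 in D.
have e1 : (fun q => eta a q (xi a q)) = (fun=> 1).
  by apply/funext => q; rewrite eta_xi eqxx.
rewrite e1 der_cst -mf_xi in D.
rewrite YE mfC (der_mf_lin g (xi a) (se p) gx (smooth_fsm p sY') gZ).
rewrite (mfC g Y') K (lie_linr gx gx (smooth_fsm p sY') (se p)) xx.
rewrite scaler0 add0r !metric_linr (metric_sym g p _ (xi a p)) metric_xi.
have -> : der (xi a) (mf g (xi a) Z) p = eta a p (lie (xi a) Z p) by lra.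
rewrite (metric_sym g p (Z p) (xi a p)) !metric_xi; ring.
Qed.

(** The bilinear form g(nabla_E xi_a, W) is symmetric in E and W because eta_a is closed, and skew
    because xi_a is Killing. It is evaluated at W = nabla_E xi_a. *)
Lemma cosymplectic_lc_xi a E p : smooth_field E -> lc g E (xi a) p = 0.
Proof.
move=> sE; have sx := smooth_xi S a; have gx := smooth_fsm p sx.
pose W := lc g E (xi a).
have sW : smooth_field W.
  by apply/smooth_fieldP => q; exact: (fsm_lc g (smooth_fsm q sE) (smooth_fsm q sx)).
have gE := smooth_fsm p sE; have gW := smooth_fsm p sW.
have K := cosymplectic_killing a p sE sW.
have D := d1E (eta a) E W p.
rewrite (d1_eta a p sE sW) mulr0 -!mf_xi in D.
rewrite (lc_metric g gE gx gW) (lc_metric g gW gx gE) in D.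
rewrite -(lc_torsion g gE gW) linearB /= -!metric_xi in D.
rewrite (lc_metric g gx gE gW) in K.
rewrite -(lc_torsion g gx gE) -(lc_torsion g gx gW) in K.
rewrite metricDl metricDr metricNl metricNr -/W in K.
rewrite -/W (metric_sym g p (lc g W (xi a) p)) in D.
apply/eqP; apply/negP => /negP nW; have := metric_pos g p nW; rewrite -/(W p).
by lra.
Qed.

(** Since nabla xi_a = 0, the Levi-Civita connection decomposes like [canon]. The horizontal
    projection changes nothing, as g(xi_a, nabla_X Y) = X(eta_a(Y)) - g(nabla_X xi_a, Y) = 0 for
    horizontal X and Y. *)
Lemma cosymplectic_canon E F : smooth_field E -> smooth_field F ->
  canon E F = lc g E F.
Proof.
move=> sE sF; apply/funext => p.
have pl : parallel_xi S (lc g) by move=> a V sV q; exact: cosymplectic_lc_xi.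
have tl a X : horizontal S X -> forall p, torsion (lc g) X (xi a) p = 0.
  move=> hX q; rewrite /torsion bracket_lie.
  by rewrite (lc_torsion g (smooth_fsm q hX.1) (fsm_xi S q a)) subrr.
rewrite (connection_decomposition p (lc_linear_connection g) pl tl sE sF) canonE.
congr (_ + _); apply: hproj_id => a.
have [sX _] := hpart_smooth S sE; have [sY Y0] := hpart_smooth S sF.
have := lc_metric g (smooth_fsm p sX) (fsm_xi S p a) (smooth_fsm p sY).
rewrite mf_xi (_ : (fun q => _) = (fun=> 0)); last first.
  by apply/funext => q; exact: Y0.
by rewrite der_cst (cosymplectic_lc_xi a p sX) metric0l add0r metric_xi.
Qed.

Lemma cosymplectic_cov_phi a E F p : smooth_field E -> smooth_field F ->
  cov_tensor11 canon (phi a) E F p = 0.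
Proof.
move=> sE sF; rewrite (cov_canon_phi Phi_closed S_normal a p sE sF).
have hF := hpart_smooth S sF; have sY := hF.1.
rewrite big1 // => b _; set V := (X in _ *: X).
suff -> : V = 0 by rewrite scaler0.
pose Z : field M := fun q => lie (xi b) (phif a (hpart S F)) q
  - phif a (lie (xi b) (hpart S F)) q.
have sZ : smooth_field Z.
  apply/smooth_fieldP => q; have sxb := fsm_xi S q b.
  apply: fsmB; first exact: (fsm_lie sxb (smooth_fsm q (smooth_phif S a sY))).
  exact: (fsm_phif S a (fsm_lie sxb (smooth_fsm q sY))).
apply/eqP; apply/negP => /negP nV; have := metric_pos g p nV.
rewrite -[X in g p X _]/(Z p) (lie_phi Phi_closed S_normal d1_xi a b p sZ hF).
rewrite big1 ?oppr0 ?ltxx // => c _.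
by rewrite (d1_eta c p sZ sY) !mulr0.
Qed.

End Cosymplectic.
End SpecialGeometries.

Theorem theorem3p6 (R : realType) (n : nat) (M : smoothManifold R (4 * n).+3)
    (S : almost_3contact_metric M) :
  exists D : field M -> field M -> field M,
    [/\ linear_connection D, preserves_horizontal S D, parallel_xi S D,
        horizontally_metric S D & torsion_condition S D] /\
    (forall D' : field M -> field M -> field M,
       linear_connection D' -> preserves_horizontal S D' ->
       parallel_xi S D' -> horizontally_metric S D' ->
       torsion_condition S D' ->
       forall E F, smooth_field E -> smooth_field F ->
       forall p, D' E F p = D E F p) /\
    canonical_connection S D /\
    (sasakian3 S ->
       forall (a : 'I_3) (E F : field M), smooth_field E -> smooth_field F ->
       forall p, cov_tensor11 D (phi3 S a) E F p =
         - \sum_b \sum_c eps R a b c *: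
             (eta3 S b p (E p) *: phi3 S c p (hpart S F p)
              - eta3 S c p (E p) *: phi3 S b p (hpart S F p))) /\
    (cosymplectic3 S ->
       levi_civita (met3 S) D /\
       forall (a : 'I_3) (E F : field M), smooth_field E -> smooth_field F ->
       forall p, cov_tensor11 D (phi3 S a) E F p = 0).
Proof.
exists (canon S); split; last split; last split; last split.
- split; [exact: canon_linear_connection|exact: canon_preserves|
    exact: canon_parallel|exact: canon_metric|exact: canon_torsion].
- exact: canon_unique.
- exact: canon_canonical.
- by move=> Ssas a E F sE sF p; exact: sasakian_cov_phi.
- move=> Scos; split; last by move=> a E F sE sF p; exact: cosymplectic_cov_phi.
  apply: (@levi_civita_eq _ _ _ (met3 S) (lc (met3 S)) (canon S)).
    by move=> E F sE sF; exact: cosymplectic_canon.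
  exact: lc_levi_civita.
Qed.
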